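(* Let $A\subset K$ be an $R$-subalgebra of Fock type, let $A^\perp$ be its orthogonal complement for the residue form, let $H_A=A^\perp/A$ with its induced form $(\,,\,)_A$, and let $F_A\subset H_A$ be the image of $A^\perp\cap\mathcal O$. Then the $R$-module $H_A$ is free of rank twice the rank of the free $R$-module $K/(A+\mathcal O)$; the form $(\,,\,)_A$ on $H_A$ is nondegenerate and has $F_A$ as a maximal isotropic subspace; and there is a natural isomorphism of $R$-modules $$\mathbb F(H_A,F_A)\cong\mathbb F(K,\mathcal O)_A,$$ namely the one that sends $x_1\circ\cdots\circ x_k\circ v_o$ (with $x_i\in H_A$) to the class of $\tilde x_1\circ\cdots\circ\tilde x_k\circ v_o$, where $\tilde x_i\in A^\perp$ is any lift of $x_i$.
   Context: $R$ is a commutative $\mathbb C$-algebra and $\mathcal O$ is an $R$-algebra isomorphic to the formal power series ring $R[[t]]$, with principal ideal $\mathfrak m$ (corresponding to $(t)$). $K$ is the localization of $\mathcal O$ at a generator of $\mathfrak m$, so $K\cong R((t))$, with the $\mathfrak m$-adic topology. $\omega_{K/R}\cong R((t))dt$ is the module of continuous relative differentials, $d:K\to\omega_{K/R}$ the universal continuous $R$-derivation, and $\operatorname{Res}:\omega_{K/R}\to R$ the residue (coefficient of $t^{-1}dt$). The residue form is the antisymmetric $R$-bilinear form $(f,g):=\operatorname{Res}(g\,df)$ on $K$; its kernel is $R$. An $R$-subalgebra $A\subset K$ is of Fock type if: (FT1) $A$ is flat and of finite type as an $R$-algebra; (FT2) $A\cap\mathcal O=R$ and the $R$-module $K/(A+\mathcal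 O)$ is free of finite rank; (FT3) $A$ is totally isotropic for the residue form; (FT4) any continuous $R$-derivation of $K$ which preserves $A$ maps $A^\perp:=\{f\in K:(f,a)=0\text{ for all }a\in A\}$ to $A$. $A^\perp$ is an $A$-submodule of $K$ containing $A$. The residue form induces the form $(a_1,a_2)_A:=\operatorname{Res}(\tilde a_2\,d\tilde a_1)$ on $H_A:=A^\perp/A$, where $\tilde a_i\in A^\perp$ lifts $a_i$. Fock representations over $R$: for an $R$-module $M$ with an antisymmetric $R$-bilinear form $(\,,\,)$, let $\hat M=M\oplus R\hbar$ with bracket $[a+r\hbar,b+r'\hbar]=(a,b)\hbar$, and write $\circ$ for the product in its universal enveloping $R$-algebra $U\hat M$. For an isotropic submodule $F\subset M$, $\mathbb F(M,F):=U\hat M\otimes_{U\hat F}R$, where $\hat F=F\oplus R\hbar$ acts on $R$ through the coefficient of $\hbar$; $v_o$ is the image of $1\otimes1$. This is applied to $(K,\mathcal O)$ with the residue form and to $(H_A,F_A)$. Finally $\mathbb F(K,\mathcal O)_A:=\mathbb F(K,\mathcal O)/A\circ\mathbb F(K,\mathcal O)$ denotes the coinvariants for the abelian Lie subalgebra $A\subset\hat K$. *)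

(* Defs.v *)
From HB Require Import structures.
From mathcomp Require Import all_boot all_algebra.
From mathcomp Require Import boolp reals complex.

Set Implicit Arguments.
Unset Strict Implicit.
Unset Printing Implicit Defensive.

Import GRing.Theory.
Local Open Scope ring_scope.
Local Open Scope quotient_scope.

Section Submodule.
Variables (R : nzRingType) (V : lmodType R) (S : submodClosed V).

Definition sub_lmod : Type := {x : V | x \in S}.
HB.instance Definition _ := SubChoice.on sub_lmod.
HB.instance Definition _ := [SubChoice_isSubLmodule of sub_lmod by <:].

(* The library quotient Quotient.quot expects a zmodClosed predicate; a submodClosed
   one is not recognised as such automatically. *)
Definition zmod_pred : {pred V} := fun x => x \in S.

Fact zmod_pred_closed : zmod_closed zmod_pred.
Proof. by case: (submodClosedP S) => S0 SZ; split=> // x y Sx Sy;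
  rewrite -scaleN1r addrC; apply: SZ. Qed.
HB.instance Definition _ := GRing.isZmodClosed.Build V zmod_pred zmod_pred_closed.

Definition quot_lmod : Type := (@Quotient.quot V zmod_pred).
HB.instance Definition _ := GRing.Zmodule.on quot_lmod.

Definition quot_pi (x : V) : quot_lmod := \pi_(@Quotient.quot V zmod_pred) x.
Definition quot_repr (x : quot_lmod) : V := repr (x : (@Quotient.quot V zmod_pred)).

Lemma quot_reprK : cancel quot_repr quot_pi.
Proof. exact: reprK. Qed.

Lemma quot_piP x y : quot_pi x = quot_pi y <-> x - y \in S.
Proof.
have -> : (x - y \in S) = (quot_pi x == quot_pi y).
  exact: (@Quotient.idealrBE V zmod_pred x y).
by split=> [->|/eqP].
Qed.

Lemma quot_piD x y : quot_pi (x + y) = quot_pi x + quot_pi y.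
Proof. exact: (raddfD (\pi_(@Quotient.quot V zmod_pred))). Qed.

Definition quot_scale (a : R) (x : quot_lmod) : quot_lmod :=
  quot_pi (a *: quot_repr x).

Lemma quot_piZ a x : quot_pi (a *: x) = quot_scale a (quot_pi x).
Proof.
apply/quot_piP; rewrite -scalerBr; apply: rpredZ.
by apply/quot_piP; rewrite quot_reprK.
Qed.

Fact quot_scaleA a b x : quot_scale a (quot_scale b x) = quot_scale (a * b) x.
Proof. by rewrite -[x]quot_reprK -!quot_piZ scalerA. Qed.
Fact quot_scale1 : left_id 1 quot_scale.
Proof. by move=> x; rewrite -[x]quot_reprK -quot_piZ scale1r. Qed.
Fact quot_scaleDr : right_distributive quot_scale +%R.
Proof.
move=> a x y; rewrite -[x]quot_reprK -[y]quot_reprK.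
by rewrite -quot_piD -!quot_piZ -quot_piD scalerDr.
Qed.
Fact quot_scaleDl x : {morph quot_scale^~ x : a b / a + b}.
Proof. by move=> a b; rewrite -[x]quot_reprK -!quot_piZ -quot_piD scalerDl. Qed.

HB.instance Definition _ := GRing.Zmodule_isLmodule.Build R quot_lmod
  quot_scaleA quot_scale1 quot_scaleDr quot_scaleDl.

Fact quot_pi_linear : linear quot_pi.
Proof. by move=> a x y; rewrite quot_piD quot_piZ. Qed.
HB.instance Definition _ := GRing.isLinear.Build R V quot_lmod *:%R quot_pi
  quot_pi_linear.

End Submodule.

Section SubmoduleOperations.
Variables (R : nzRingType) (V W : lmodType R).

Definition sum_sub (S T : submodClosed V) : {pred V} :=
  fun x => `[< exists s t, [/\ s \in S, t \in T & x = s + t] >].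

Fact sum_sub_closed S T : submod_closed (sum_sub S T).
Proof.
split=> [|a x y /asboolP[s [t [Ss Tt ->]]] /asboolP[s' [t' [Ss' Tt' ->]]]].
  by apply/asboolP; exists 0, 0; rewrite !rpred0 addr0.
apply/asboolP; exists (a *: s + s'), (a *: t + t').
by rewrite scalerDr addrACA !rpredD ?rpredZ.
Qed.
HB.instance Definition _ S T :=
  GRing.isSubmodClosed.Build R V (sum_sub S T) (sum_sub_closed S T).

Definition preim_sub (f : {linear V -> W}) (S : submodClosed W) : {pred V} :=
  fun x => f x \in S.

Fact preim_sub_closed f S : submod_closed (preim_sub f S).
Proof.
split=> [|a x y Sx Sy]; first by rewrite unfold_in /preim_sub linear0 rpred0.
by rewrite unfold_in /preim_sub linearP rpredD ?rpredZ.
Qed.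
HB.instance Definition _ f S :=
  GRing.isSubmodClosed.Build R V (preim_sub f S) (preim_sub_closed f S).

Definition im_sub (f : {linear V -> W}) (S : submodClosed V) : {pred W} :=
  fun y => `[< exists2 x, x \in S & y = f x >].

Fact im_sub_closed f S : submod_closed (im_sub f S).
Proof.
split=> [|a _ _ /asboolP[x Sx ->] /asboolP[y Sy ->]].
  by apply/asboolP; exists 0; rewrite ?rpred0 ?linear0.
by apply/asboolP; exists (a *: x + y); rewrite ?linearP ?rpredD ?rpredZ.
Qed.
HB.instance Definition _ f S :=
  GRing.isSubmodClosed.Build R W (im_sub f S) (im_sub_closed f S).

End SubmoduleOperations.

Definition free_of_rank (R : nzRingType) (V : lmodType R) (n : nat) : Prop :=
  exists f : {linear 'rV[R]_n -> V}, bijective f.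

(* X (x)_S Y for R-modules X and Y, where S acts R-compatibly on X from the right
   (ra) and on Y from the left (la): the R-module generated by symbols x (x) y
   subject to R-bilinearity and  x s (x) y = x (x) s y.  It is built as the set
   of formal expressions modulo the smallest congruence containing the module
   axioms and these relations. *)
Section Tensor.
Variables (R : comNzRingType) (X Y : lmodType R) (S : Type).
Variables (ra : X -> S -> X) (la : S -> Y -> Y).

Inductive tterm : Type :=
  | TPure of X & Y
  | TZero
  | TAdd of tterm & tterm
  | TOpp of tterm
  | TScale of R & tterm.

Inductive teq : tterm -> tterm -> Prop :=
  | teq_refl u : teq u u
  | teq_sym u v : teq u v -> teq v u
  | teq_trans v u w : teq u v -> teq v w -> teq u w
  | teq_add u u' v v' : teq u u' -> teq v v' -> teq (TAdd u v) (TAdd u' v')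
  | teq_opp u u' : teq u u' -> teq (TOpp u) (TOpp u')
  | teq_scale a u u' : teq u u' -> teq (TScale a u) (TScale a u')
  | teq_addA u v w : teq (TAdd u (TAdd v w)) (TAdd (TAdd u v) w)
  | teq_addC u v : teq (TAdd u v) (TAdd v u)
  | teq_add0 u : teq (TAdd TZero u) u
  | teq_addN u : teq (TAdd (TOpp u) u) TZero
  | teq_scaleA a b u : teq (TScale a (TScale b u)) (TScale (a * b) u)
  | teq_scale1 u : teq (TScale 1 u) u
  | teq_scaleDr a u v : teq (TScale a (TAdd u v)) (TAdd (TScale a u) (TScale a v))
  | teq_scaleDl u a b : teq (TScale (a + b) u) (TAdd (TScale a u) (TScale b u))
  | teq_pureDl x x' y : teq (TPure (x + x') y) (TAdd (TPure x y) (TPure x' y))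
  | teq_pureDr x y y' : teq (TPure x (y + y')) (TAdd (TPure x y) (TPure x y'))
  | teq_pureZl a x y : teq (TPure (a *: x) y) (TScale a (TPure x y))
  | teq_pureZr a x y : teq (TPure x (a *: y)) (TScale a (TPure x y))
  | teq_balanced x s y : teq (TPure (ra x s) y) (TPure x (la s y)).

HB.instance Definition _ := gen_eqMixin tterm.
HB.instance Definition _ := gen_choiceMixin tterm.

Definition teqb : rel tterm := fun u v => `[< teq u v >].

Fact teqb_equiv : equiv_class_of teqb.
Proof.
split=> [u|u v|v u w]; first exact/asboolP/teq_refl.
  by apply/asboolP/asboolP; apply: teq_sym.
by move=> /asboolP uv /asboolP vw; apply/asboolP/(teq_trans uv vw).
Qed.
Canonical teqb_equiv_rel := EquivRelPack teqb_equiv.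
Canonical teqb_encModRel := defaultEncModRel teqb.

Definition tensor : Type := {eq_quot teqb}.
HB.instance Definition _ := Choice.on tensor.

Definition tclass (u : tterm) : tensor := \pi_({eq_quot teqb}) u.
Definition trepr (x : tensor) : tterm := repr (x : {eq_quot teqb}).

Lemma treprK : cancel trepr tclass. Proof. exact: reprK. Qed.
Lemma tclassP u v : tclass u = tclass v <-> teq u v.
Proof.
split=> [H|H]; first by apply/asboolP; rewrite -/(teqb u v) -eqmodE; apply/eqP.
by apply/eqP; rewrite eqmodE; apply/asboolP.
Qed.
Lemma tcanon u : teq (trepr (tclass u)) u.
Proof. by apply/tclassP; rewrite treprK. Qed.

Definition tensor_add (x y : tensor) := tclass (TAdd (trepr x) (trepr y)).
Definition tensor_opp (x : tensor) := tclass (TOpp (trepr x)).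
Definition tensor_scale a (x : tensor) := tclass (TScale a (trepr x)).

Lemma tclassD u v : tclass (TAdd u v) = tensor_add (tclass u) (tclass v).
Proof. by apply/tclassP/teq_sym/teq_add; apply: tcanon. Qed.
Lemma tclassN u : tclass (TOpp u) = tensor_opp (tclass u).
Proof. by apply/tclassP/teq_sym/teq_opp; apply: tcanon. Qed.
Lemma tclassZ a u : tclass (TScale a u) = tensor_scale a (tclass u).
Proof. by apply/tclassP/teq_sym/teq_scale; apply: tcanon. Qed.

Fact tensor_addA : associative tensor_add.
Proof.
move=> x y z; rewrite -[x]treprK -[y]treprK -[z]treprK -!tclassD.
exact/tclassP/teq_addA.
Qed.
Fact tensor_addC : commutative tensor_add.
Proof.
move=> x y; rewrite -[x]treprK -[y]treprK -!tclassD; exact/tclassP/teq_addC.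
Qed.
Fact tensor_add0 : left_id (tclass TZero) tensor_add.
Proof. move=> x; rewrite -[x]treprK -!tclassD; exact/tclassP/teq_add0. Qed.
Fact tensor_addN : left_inverse (tclass TZero) tensor_opp tensor_add.
Proof.
move=> x; rewrite -[x]treprK -!(tclassN, tclassD); exact/tclassP/teq_addN.
Qed.
HB.instance Definition _ := GRing.isZmodule.Build tensor
  tensor_addA tensor_addC tensor_add0 tensor_addN.

Fact tensor_scaleA a b x :
  tensor_scale a (tensor_scale b x) = tensor_scale (a * b) x.
Proof. rewrite -[x]treprK -!tclassZ; exact/tclassP/teq_scaleA. Qed.
Fact tensor_scale1 : left_id 1 tensor_scale.
Proof. move=> x; rewrite -[x]treprK -!tclassZ; exact/tclassP/teq_scale1. Qed.
Fact tensor_scaleDr : right_distributive tensor_scale +%R.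
Proof.
move=> a x y; rewrite -[x]treprK -[y]treprK.
rewrite -[_ + _]tclassD -!tclassZ -[RHS]tclassD; exact/tclassP/teq_scaleDr.
Qed.
Fact tensor_scaleDl x : {morph tensor_scale^~ x : a b / a + b}.
Proof.
move=> a b; rewrite -[x]treprK -!tclassZ -[RHS]tclassD.
exact/tclassP/teq_scaleDl.
Qed.
HB.instance Definition _ := GRing.Zmodule_isLmodule.Build R tensor
  tensor_scaleA tensor_scale1 tensor_scaleDr tensor_scaleDl.

Definition tpure (x : X) (y : Y) : tensor := tclass (TPure x y).

(* The linear map x (x) y |-> h x y; it is meaningful when h respects the
   defining relations (tlift_pure). *)
Fixpoint teval (P : lmodType R) (h : X -> Y -> P) (u : tterm) : P :=
  match u with
  | TPure x y => h x y
  | TZero => 0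
  | TAdd u v => teval h u + teval h v
  | TOpp u => - teval h u
  | TScale a u => a *: teval h u
  end.

Definition tlift (P : lmodType R) (h : X -> Y -> P) (x : tensor) : P :=
  teval h (trepr x).

Definition tensor_compat (P : lmodType R) (h : X -> Y -> P) : Prop :=
  [/\ forall y, linear (h^~ y), forall x, linear (h x)
    & forall x s y, h (ra x s) y = h x (la s y)].

Section Lift.
Variables (P : lmodType R) (h : X -> Y -> P) (hP : tensor_compat h).

Lemma teval_eq u v : teq u v -> teval h u = teval h v.
Proof.
case: hP => hl hr hb.
elim=> {u v} //=.
- by move=> v u w _ -> _ ->.
- by move=> u u' v v' _ -> _ ->.
- by move=> u u' _ ->.
- by move=> a u u' _ ->.
- by move=> *; rewrite addrA.
- by move=> *; rewrite addrC.
- by move=> *; rewrite add0r.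
- by move=> *; rewrite addNr.
- by move=> *; rewrite scalerA.
- by move=> *; rewrite scale1r.
- by move=> *; rewrite scalerDr.
- by move=> *; rewrite scalerDl.
- by move=> x x' y; have := hl y 1 x x'; rewrite !scale1r.
- by move=> x y y'; have := hr x 1 y y'; rewrite !scale1r.
- move=> a x y; have h0 : h 0 y = 0.
    by have /eqP := hl y 1 0 0; rewrite !scale1r addr0 -subr_eq0 opprD addNKr oppr_eq0 => /eqP.
  by have := hl y a x 0; rewrite h0 !addr0.
- move=> a x y; have h0 : h x 0 = 0.
    by have /eqP := hr x 1 0 0; rewrite !scale1r addr0 -subr_eq0 opprD addNKr oppr_eq0 => /eqP.
  by have := hr x a y 0; rewrite h0 !addr0.
Qed.

Lemma tlift_class u : tlift h (tclass u) = teval h u.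
Proof. exact/teval_eq/tcanon. Qed.

Lemma tlift_pure x y : tlift h (tpure x y) = h x y.
Proof. exact: tlift_class. Qed.

Lemma tlift_linear : linear (tlift h).
Proof.
move=> a x y; rewrite -[x]treprK -[y]treprK.
by rewrite -[a *: _]tclassZ -[_ + tclass _]tclassD !tlift_class.
Qed.
End Lift.

End Tensor.

Definition tens (R : comNzRingType) (X Y : lmodType R) : lmodType R :=
  tensor (fun (x : X) (a : R) => a *: x) (fun (a : R) (y : Y) => a *: y).

Definition tens_map (R : comNzRingType) (X M N : lmodType R) (f : M -> N) :
    tens X M -> tens X N :=
  tlift (fun x m => tpure _ _ x (f m)).

Definition flat (R : comNzRingType) (X : lmodType R) : Prop :=
  forall (M N : lmodType R) (f : {linear M -> N}),
    injective f -> injective (@tens_map R X M N f).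

(* The associative unital R-algebra generated by the R-module L subject to
   x y - y x = [x, y], again as formal expressions modulo the smallest
   congruence containing the algebra axioms, the linearity of the generators and
   the bracket relation. *)
Section Enveloping.
Variables (R : comNzRingType) (L : lmodType R) (br : L -> L -> L).

Inductive uterm : Type :=
  | UGen of L
  | UZero
  | UOne
  | UAdd of uterm & uterm
  | UOpp of uterm
  | UMul of uterm & uterm
  | UScale of R & uterm.

Inductive ueq : uterm -> uterm -> Prop :=
  | ueq_refl u : ueq u u
  | ueq_sym u v : ueq u v -> ueq v u
  | ueq_trans v u w : ueq u v -> ueq v w -> ueq u w
  | ueq_add u u' v v' : ueq u u' -> ueq v v' -> ueq (UAdd u v) (UAdd u' v')
  | ueq_opp u u' : ueq u u' -> ueq (UOpp u) (UOpp u')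
  | ueq_mul u u' v v' : ueq u u' -> ueq v v' -> ueq (UMul u v) (UMul u' v')
  | ueq_scale a u u' : ueq u u' -> ueq (UScale a u) (UScale a u')
  | ueq_addA u v w : ueq (UAdd u (UAdd v w)) (UAdd (UAdd u v) w)
  | ueq_addC u v : ueq (UAdd u v) (UAdd v u)
  | ueq_add0 u : ueq (UAdd UZero u) u
  | ueq_addN u : ueq (UAdd (UOpp u) u) UZero
  | ueq_mulA u v w : ueq (UMul u (UMul v w)) (UMul (UMul u v) w)
  | ueq_mul1l u : ueq (UMul UOne u) u
  | ueq_mul1r u : ueq (UMul u UOne) u
  | ueq_mulDl u v w : ueq (UMul (UAdd u v) w) (UAdd (UMul u w) (UMul v w))
  | ueq_mulDr u v w : ueq (UMul u (UAdd v w)) (UAdd (UMul u v) (UMul u w))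
  | ueq_scaleA a b u : ueq (UScale a (UScale b u)) (UScale (a * b) u)
  | ueq_scale1 u : ueq (UScale 1 u) u
  | ueq_scaleDr a u v : ueq (UScale a (UAdd u v)) (UAdd (UScale a u) (UScale a v))
  | ueq_scaleDl u a b : ueq (UScale (a + b) u) (UAdd (UScale a u) (UScale b u))
  | ueq_scaleAl a u v : ueq (UScale a (UMul u v)) (UMul (UScale a u) v)
  | ueq_scaleAr a u v : ueq (UScale a (UMul u v)) (UMul u (UScale a v))
  | ueq_genD x y : ueq (UGen (x + y)) (UAdd (UGen x) (UGen y))
  | ueq_genZ a x : ueq (UGen (a *: x)) (UScale a (UGen x))
  | ueq_bracket x y :
      ueq (UAdd (UMul (UGen x) (UGen y)) (UOpp (UMul (UGen y) (UGen x))))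
          (UGen (br x y)).

HB.instance Definition _ := gen_eqMixin uterm.
HB.instance Definition _ := gen_choiceMixin uterm.

Definition ueqb : rel uterm := fun u v => `[< ueq u v >].

Fact ueqb_equiv : equiv_class_of ueqb.
Proof.
split=> [u|u v|v u w]; first exact/asboolP/ueq_refl.
  by apply/asboolP/asboolP; apply: ueq_sym.
by move=> /asboolP uv /asboolP vw; apply/asboolP/(ueq_trans uv vw).
Qed.
Canonical ueqb_equiv_rel := EquivRelPack ueqb_equiv.
Canonical ueqb_encModRel := defaultEncModRel ueqb.

Definition uenv : Type := {eq_quot ueqb}.
HB.instance Definition _ := Choice.on uenv.

Definition uclass (u : uterm) : uenv := \pi_({eq_quot ueqb}) u.
Definition urepr (x : uenv) : uterm := repr (x : {eq_quot ueqb}).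

Lemma ureprK : cancel urepr uclass. Proof. exact: reprK. Qed.
Lemma uclassP u v : uclass u = uclass v <-> ueq u v.
Proof.
split=> [H|H]; first by apply/asboolP; rewrite -/(ueqb u v) -eqmodE; apply/eqP.
by apply/eqP; rewrite eqmodE; apply/asboolP.
Qed.
Lemma ucanon u : ueq (urepr (uclass u)) u.
Proof. by apply/uclassP; rewrite ureprK. Qed.

Definition uenv_add (x y : uenv) := uclass (UAdd (urepr x) (urepr y)).
Definition uenv_opp (x : uenv) := uclass (UOpp (urepr x)).
Definition uenv_mul (x y : uenv) := uclass (UMul (urepr x) (urepr y)).
Definition uenv_scale a (x : uenv) := uclass (UScale a (urepr x)).

Lemma uclassD u v : uclass (UAdd u v) = uenv_add (uclass u) (uclass v).
Proof. by apply/uclassP/ueq_sym/ueq_add; apply: ucanon. Qed.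
Lemma uclassN u : uclass (UOpp u) = uenv_opp (uclass u).
Proof. by apply/uclassP/ueq_sym/ueq_opp; apply: ucanon. Qed.
Lemma uclassM u v : uclass (UMul u v) = uenv_mul (uclass u) (uclass v).
Proof. by apply/uclassP/ueq_sym/ueq_mul; apply: ucanon. Qed.
Lemma uclassZ a u : uclass (UScale a u) = uenv_scale a (uclass u).
Proof. by apply/uclassP/ueq_sym/ueq_scale; apply: ucanon. Qed.

Fact uenv_addA : associative uenv_add.
Proof.
move=> x y z; rewrite -[x]ureprK -[y]ureprK -[z]ureprK -!uclassD.
exact/uclassP/ueq_addA.
Qed.
Fact uenv_addC : commutative uenv_add.
Proof.
move=> x y; rewrite -[x]ureprK -[y]ureprK -!uclassD; exact/uclassP/ueq_addC.
Qed.
Fact uenv_add0 : left_id (uclass UZero) uenv_add.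
Proof. move=> x; rewrite -[x]ureprK -!uclassD; exact/uclassP/ueq_add0. Qed.
Fact uenv_addN : left_inverse (uclass UZero) uenv_opp uenv_add.
Proof.
move=> x; rewrite -[x]ureprK -!(uclassN, uclassD); exact/uclassP/ueq_addN.
Qed.
HB.instance Definition _ := GRing.isZmodule.Build uenv
  uenv_addA uenv_addC uenv_add0 uenv_addN.

(* Evaluation of expressions under a linear map f from L to an algebra: it
   respects ueq when f [x, y] = f x f y - f y f x. *)
Fixpoint ueval (B : algType R) (f : L -> B) (u : uterm) : B :=
  match u with
  | UGen x => f x
  | UZero => 0
  | UOne => 1
  | UAdd u v => ueval f u + ueval f v
  | UOpp u => - ueval f u
  | UMul u v => ueval f u * ueval f v
  | UScale a u => a *: ueval f u
  end.

Lemma ueval_eq (B : algType R) (f : L -> B) :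
    linear f -> (forall x y, f (br x y) = f x * f y - f y * f x) ->
  forall u v, ueq u v -> ueval f u = ueval f v.
Proof.
move=> fl fbr u v; elim=> {u v} //=.
- by move=> v u w _ -> _ ->.
- by move=> u u' v v' _ -> _ ->.
- by move=> u u' _ ->.
- by move=> u u' v v' _ -> _ ->.
- by move=> a u u' _ ->.
- by move=> *; rewrite addrA.
- by move=> *; rewrite addrC.
- by move=> *; rewrite add0r.
- by move=> *; rewrite addNr.
- by move=> *; rewrite mulrA.
- by move=> *; rewrite mul1r.
- by move=> *; rewrite mulr1.
- by move=> *; rewrite mulrDl.
- by move=> *; rewrite mulrDr.
- by move=> *; rewrite scalerA.
- by move=> *; rewrite scale1r.
- by move=> *; rewrite scalerDr.
- by move=> *; rewrite scalerDl.
- by move=> *; rewrite scalerAl.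
- by move=> *; rewrite scalerAr.
- by move=> x y; have := fl 1 x y; rewrite !scale1r.
- move=> a x; have f0 : f 0 = 0.
    by have /eqP := fl 1 0 0; rewrite !scale1r addr0 -subr_eq0 opprD addNKr oppr_eq0 => /eqP.
  by have := fl a x 0; rewrite f0 !addr0.
Qed.

Fact uenv_mulA : associative uenv_mul.
Proof.
move=> x y z; rewrite -[x]ureprK -[y]ureprK -[z]ureprK -!uclassM.
exact/uclassP/ueq_mulA.
Qed.
Fact uenv_mul1l : left_id (uclass UOne) uenv_mul.
Proof. move=> x; rewrite -[x]ureprK -!uclassM; exact/uclassP/ueq_mul1l. Qed.
Fact uenv_mul1r : right_id (uclass UOne) uenv_mul.
Proof. move=> x; rewrite -[x]ureprK -!uclassM; exact/uclassP/ueq_mul1r. Qed.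
Fact uenv_mulDl : left_distributive uenv_mul +%R.
Proof.
move=> x y z; rewrite -[x]ureprK -[y]ureprK -[z]ureprK.
rewrite -[_ + _]uclassD -!uclassM -[RHS]uclassD; exact/uclassP/ueq_mulDl.
Qed.
Fact uenv_mulDr : right_distributive uenv_mul +%R.
Proof.
move=> x y z; rewrite -[x]ureprK -[y]ureprK -[z]ureprK.
rewrite -[uclass (urepr y) + _]uclassD -!uclassM -[RHS]uclassD.
exact/uclassP/ueq_mulDr.
Qed.
Fact uenv_oner_neq0 : uclass UOne != 0.
Proof.
apply/eqP => /uclassP /(@ueval_eq R^o (fun=> 0)) /= H.
have /eqP : (1 : R^o) = 0.
  by apply: H => [a x y|x y]; rewrite ?scaler0 ?mulr0 ?addr0 ?subrr.
by rewrite oner_eq0.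
Qed.
HB.instance Definition _ := GRing.Zmodule_isNzRing.Build uenv
  uenv_mulA uenv_mul1l uenv_mul1r uenv_mulDl uenv_mulDr uenv_oner_neq0.

Fact uenv_scaleA a b x : uenv_scale a (uenv_scale b x) = uenv_scale (a * b) x.
Proof. rewrite -[x]ureprK -!uclassZ; exact/uclassP/ueq_scaleA. Qed.
Fact uenv_scale1 : left_id 1 uenv_scale.
Proof. move=> x; rewrite -[x]ureprK -!uclassZ; exact/uclassP/ueq_scale1. Qed.
Fact uenv_scaleDr : right_distributive uenv_scale +%R.
Proof.
move=> a x y; rewrite -[x]ureprK -[y]ureprK.
rewrite -[_ + _]uclassD -!uclassZ -[RHS]uclassD; exact/uclassP/ueq_scaleDr.
Qed.
Fact uenv_scaleDl x : {morph uenv_scale^~ x : a b / a + b}.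
Proof.
move=> a b; rewrite -[x]ureprK -!uclassZ -[RHS]uclassD; exact/uclassP/ueq_scaleDl.
Qed.
HB.instance Definition _ := GRing.Zmodule_isLmodule.Build R uenv
  uenv_scaleA uenv_scale1 uenv_scaleDr uenv_scaleDl.

Fact uenv_scaleAl (a : R) (x y : uenv) : a *: (x * y) = (a *: x) * y.
Proof.
rewrite -[x]ureprK -[y]ureprK -[_ * _]uclassM -![a *: _]uclassZ -[RHS]uclassM.
exact/uclassP/ueq_scaleAl.
Qed.
HB.instance Definition _ := GRing.Lmodule_isLalgebra.Build R uenv uenv_scaleAl.
Fact uenv_scaleAr (a : R) (x y : uenv) : a *: (x * y) = x * (a *: y).
Proof.
rewrite -[x]ureprK -[y]ureprK -[_ * _]uclassM -![a *: _]uclassZ -[RHS]uclassM.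
exact/uclassP/ueq_scaleAr.
Qed.
HB.instance Definition _ := GRing.Lalgebra_isAlgebra.Build R uenv uenv_scaleAr.

Definition ugen (x : L) : uenv := uclass (UGen x).

Lemma ugen_linear : linear ugen.
Proof.
move=> a x y; rewrite -[a *: ugen x]uclassZ -[RHS]uclassD; apply/uclassP.
apply: ueq_trans (ueq_genD _ _) _; apply: ueq_add (ueq_refl _).
exact: ueq_genZ.
Qed.

Lemma ugen_bracket x y : ugen x * ugen y - ugen y * ugen x = ugen (br x y).
Proof.
rewrite -![_ * _]uclassM -[- _]uclassN -[LHS]uclassD; exact/uclassP/ueq_bracket.
Qed.

(* The algebra morphism extending f, meaningful under the hypotheses of
   uliftP. *)
Definition ulift (B : algType R) (f : L -> B) (x : uenv) : B :=
  ueval f (urepr x).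

Lemma uliftP (B : algType R) (f : L -> B) :
    linear f -> (forall x y, f (br x y) = f x * f y - f y * f x) ->
  [/\ linear (ulift f), monoid_morphism (ulift f)
    & forall x, ulift f (ugen x) = f x].
Proof.
move=> fl fbr; have liftE u : ulift f (uclass u) = ueval f u.
  exact/ueval_eq/ucanon.
split=> [a x y||x]; last exact: liftE.
  rewrite -[x]ureprK -[y]ureprK.
  by rewrite -[a *: _]uclassZ -[_ + uclass _]uclassD !liftE.
split=> [|x y]; first exact: liftE.
by rewrite -[x]ureprK -[y]ureprK -[_ * _]uclassM !liftE.
Qed.

End Enveloping.

Section Forms.
Variables (R : comNzRingType) (V : lmodType R) (b : V -> V -> R).

Definition isotropic (F : submodClosed V) : Prop :=
  {in F &, forall x y, b x y = 0}.

Definition maximal_isotropic (F : submodClosed V) : Prop :=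
  isotropic F /\
  forall G : submodClosed V,
    isotropic G -> {subset F <= G} -> {subset G <= F}.

(* The form identifies V with its R-dual: its radical is zero, and every linear
   form is b x for some x. *)
Definition nondegenerate_form : Prop :=
  (forall x, (forall y, b x y = 0) -> x = 0) /\
  (forall phi : {linear V -> R^o}, exists x, forall y, phi y = b x y).

End Forms.

Section Fock.
(* b is an antisymmetric bilinear form in all uses; the definitions below do not
   need these properties. *)
Variables (R : comNzRingType) (M : lmodType R) (b : M -> M -> R).

(* M (+) R hbar, the pair (a, r) standing for a + r hbar. *)
Definition hat (N : lmodType R) : lmodType R := (N * R^o)%type.

Definition hat_bracket (N : lmodType R) (c : N -> N -> R) (x y : hat N) : hat N :=
  (0, c x.1 y.1).

Definition Uhat : algType R := uenv (hat_bracket b).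

Definition hat_incl (x : M) : Uhat := ugen (hat_bracket b) (x, 0).

Variable F : submodClosed M.

Definition sub_form (x y : sub_lmod F) : R := b (val x) (val y).
Definition Uhat_sub : algType R := uenv (hat_bracket sub_form).

(* U F^ -> U M^ induced by the inclusion of F^ in M^. *)
Definition Uhat_incl : Uhat_sub -> Uhat :=
  ulift (fun x : hat (sub_lmod F) => ugen (hat_bracket b) (val x.1, x.2)).

(* U F^ -> R extending the coefficient of hbar, which is a Lie algebra character
   of F^ when F is isotropic. *)
Definition Uhat_char : Uhat_sub -> R^o :=
  ulift (fun x : hat (sub_lmod F) => x.2).

(* U M^ (x)_(U F^) R *)
Definition fock : lmodType R :=
  tensor (fun (u : Uhat) (s : Uhat_sub) => u * Uhat_incl s)
         (fun (s : Uhat_sub) (r : R^o) => Uhat_char s * r).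

Definition fock_act (u : Uhat) : fock -> fock :=
  tlift (fun (u' : Uhat) (r : R^o) => tpure _ _ (u * u') r).

Definition vacuum : fock := tpure _ _ (1 : Uhat) (1 : R^o).

(* x o w *)
Definition fock_op (x : M) (w : fock) : fock := fock_act (hat_incl x) w.

Definition fock_word (xs : seq M) : fock := foldr fock_op vacuum xs.

Lemma fock_act_compat (u : Uhat) :
  tensor_compat (fun (u : Uhat) (s : Uhat_sub) => u * Uhat_incl s)
    (fun (s : Uhat_sub) (r : R^o) => Uhat_char s * r)
    (fun (u' : Uhat) (r : R^o) => tpure _ _ (u * u') r : fock).
Proof.
split=> [r a x y|x a r r'|x s r].
- rewrite mulrDr -scalerAr -[a *: tpure _ _ _ _]tclassZ -[RHS]tclassD.
  apply/tclassP; apply: teq_trans (teq_pureDl _ _ _ _ _) _.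
  exact/teq_add/teq_refl/teq_pureZl.
- rewrite -[a *: tpure _ _ _ _]tclassZ -[RHS]tclassD.
  apply/tclassP; apply: teq_trans (teq_pureDr _ _ _ _ _) _.
  exact/teq_add/teq_refl/teq_pureZr.
by rewrite mulrA; apply/tclassP/teq_balanced.
Qed.

Lemma fock_act_linear u : linear (fock_act u).
Proof. exact/tlift_linear/fock_act_compat. Qed.

(* A o F(M, F): the finite sums of elements a o w. *)
Definition act_sub (A : submodClosed M) : {pred fock} :=
  fun w => `[< exists s : seq (M * fock),
    all (fun p => p.1 \in A) s /\ w = \sum_(p <- s) fock_op p.1 p.2 >].

Fact act_sub_closed A : submod_closed (act_sub A).
Proof.
split=> [|a _ _ /asboolP[s [sA ->]] /asboolP[s' [sA' ->]]].
  by apply/asboolP; exists [::]; rewrite big_nil.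
apply/asboolP; exists ([seq (p.1, a *: p.2) | p <- s] ++ s').
rewrite all_cat all_map sA sA' big_cat big_map scaler_sumr; split=> //.
congr (_ + _); apply: eq_bigr => p _ /=; rewrite /fock_op.
have /GRing.scalable_linear HZ := fock_act_linear (hat_incl p.1).
by rewrite -HZ.
Qed.
HB.instance Definition _ A :=
  GRing.isSubmodClosed.Build R fock (act_sub A) (act_sub_closed A).

Definition coinvariants (A : submodClosed M) : lmodType R :=
  quot_lmod (act_sub A).

End Fock.

Record fps (R : Type) := Fps { fps_coef : nat -> R }.

HB.instance Definition _ (R : Type) := gen_eqMixin (fps R).
HB.instance Definition _ (R : Type) := gen_choiceMixin (fps R).

Section FormalPowerSeries.
Variable R : comNzRingType.
Implicit Types f g h : fps R.

Lemma fpsP f g : fps_coef f =1 fps_coef g -> f = g.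
Proof. by case: f g => [f] [g] /= /funext ->. Qed.

Definition fps_const (a : R) : fps R := Fps (fun n => if n == 0%N then a else 0).
Definition fpsX : fps R := Fps (fun n => (n == 1%N)%:R).
Definition fps_add f g := Fps (fun n => fps_coef f n + fps_coef g n).
Definition fps_opp f := Fps (fun n => - fps_coef f n).
Definition fps_scale a f := Fps (fun n => a * fps_coef f n).
Definition fps_mul f g :=
  Fps (fun n => \sum_(i < n.+1) fps_coef f i * fps_coef g (n - i)%N).
Definition fps_deriv f : fps R := Fps (fun n => fps_coef f n.+1 *+ n.+1).

Fact fps_addA : associative fps_add.
Proof. by move=> f g h; apply: fpsP => n /=; rewrite addrA. Qed.
Fact fps_addC : commutative fps_add.
Proof. by move=> f g; apply: fpsP => n /=; rewrite addrC. Qed.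
Fact fps_add0 : left_id (Fps (fun=> 0)) fps_add.
Proof. by move=> f; apply: fpsP => n /=; rewrite add0r. Qed.
Fact fps_addN : left_inverse (Fps (fun=> 0)) fps_opp fps_add.
Proof. by move=> f; apply: fpsP => n /=; rewrite addNr. Qed.
HB.instance Definition _ := GRing.isZmodule.Build (fps R)
  fps_addA fps_addC fps_add0 fps_addN.

Lemma fps_mulE_rev f g n :
  fps_coef (fps_mul f g) n = \sum_(i < n.+1) fps_coef f (n - i)%N * fps_coef g i.
Proof.
rewrite /= (reindex_inj rev_ord_inj) /=; apply: eq_bigr => i _.
by rewrite subSS subKn // -ltnS.
Qed.

Fact fps_mulC : commutative fps_mul.
Proof.
move=> f g; apply: fpsP => n; rewrite fps_mulE_rev.
by apply: eq_bigr => i _; rewrite mulrC.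
Qed.
Fact fps_mulA : associative fps_mul.
Proof.
move=> f g h; apply: fpsP => i; rewrite [RHS]fps_mulE_rev [LHS]/fps_coef.
pose coef3 j k := fps_coef f j * (fps_coef g (i - j - k)%N * fps_coef h k).
transitivity (\sum_(j < i.+1) \sum_(k < i.+1 | (k <= i - j)%N) coef3 j k).
  apply: eq_bigr => j _; rewrite (fps_mulE_rev g h (i - j)%N) big_distrr /=.
  by rewrite (big_ord_narrow_leq (leq_subr _ _)).
rewrite (exchange_big_dep predT) //=; apply: eq_bigr => k _.
transitivity (\sum_(j < i.+1 | (j <= i - k)%N) coef3 j k).
  apply: eq_bigl => j; rewrite -ltnS -(ltnS j) -!subSn ?leq_ord //.
  by rewrite -subn_gt0 -(subn_gt0 j) -!subnDA addnC.
rewrite (big_ord_narrow_leq (leq_subr _ _)) big_distrl /=.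
by apply: eq_bigr => j _; rewrite /coef3 -!subnDA addnC mulrA.
Qed.
Fact fps_mul1 : left_id (fps_const 1) fps_mul.
Proof.
move=> f; apply: fpsP => n /=; rewrite big_ord_recl /= mul1r subn0.
by rewrite big1 ?addr0 // => i _; rewrite mul0r.
Qed.
Fact fps_mulDl : left_distributive fps_mul +%R.
Proof.
move=> f g h; apply: fpsP => n /=; rewrite -big_split /=.
by apply: eq_bigr => i _; rewrite mulrDl.
Qed.
Fact fps_one_neq0 : fps_const 1 != 0 :> fps R.
Proof. by apply/eqP => -[] /(congr1 (@^~ 0%N)) /= /eqP; rewrite oner_eq0. Qed.
HB.instance Definition _ := GRing.Zmodule_isComNzRing.Build (fps R)
  fps_mulA fps_mulC fps_mul1 fps_mulDl fps_one_neq0.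

Fact fps_scaleA a b f : fps_scale a (fps_scale b f) = fps_scale (a * b) f.
Proof. by apply: fpsP => n /=; rewrite mulrA. Qed.
Fact fps_scale1 : left_id 1 fps_scale.
Proof. by move=> f; apply: fpsP => n /=; rewrite mul1r. Qed.
Fact fps_scaleDr : right_distributive fps_scale +%R.
Proof. by move=> a f g; apply: fpsP => n /=; rewrite mulrDr. Qed.
Fact fps_scaleDl f : {morph fps_scale^~ f : a b / a + b}.
Proof. by move=> a b; apply: fpsP => n /=; rewrite mulrDl. Qed.
HB.instance Definition _ := GRing.Zmodule_isLmodule.Build R (fps R)
  fps_scaleA fps_scale1 fps_scaleDr fps_scaleDl.
Fact fps_scaleAl (a : R) (f g : fps R) : a *: (f * g) = (a *: f) * g.
Proof.
apply: fpsP => n /=; rewrite big_distrr /=.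
by apply: eq_bigr => i _; rewrite mulrA.
Qed.
HB.instance Definition _ := GRing.Lmodule_isLalgebra.Build R (fps R) fps_scaleAl.
HB.instance Definition _ := GRing.Lalgebra_isComAlgebra.Build R (fps R).

Lemma fps_coefMX f n :
  fps_coef (f * fpsX) n = if n is m.+1 then fps_coef f m else 0.
Proof.
rewrite [LHS]fps_mulE_rev; case: n => [|n] /=.
  by rewrite big_ord_recl big_ord0 /= mulr0 addr0.
rewrite !big_ord_recl /= mulr0 add0r mulr1 subSS subn0 big1 ?addr0 // => i _.
by rewrite mulr0.
Qed.

Lemma fps_coefMXn f k n :
  fps_coef (f * fpsX ^+ k) n = if (n < k)%N then 0 else fps_coef f (n - k)%N.
Proof.
elim: k f n => [|k IH] f n; first by rewrite mulr1 subn0.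
by rewrite exprSr mulrA fps_coefMX; case: n.
Qed.

Lemma fps_mulIXn k : injective (fun f : fps R => f * fpsX ^+ k).
Proof.
move=> f g fg; apply: fpsP => n.
have : fps_coef (f * fpsX ^+ k) (n + k) = fps_coef (g * fpsX ^+ k) (n + k).
  by congr (fps_coef _ _); apply: fg.
by rewrite !fps_coefMXn ltnNge leq_addl addnK.
Qed.

Lemma fps_derivD f g : fps_deriv (f + g) = fps_deriv f + fps_deriv g.
Proof. by apply: fpsP => n /=; rewrite mulrnDl. Qed.
Lemma fps_derivZ a f : fps_deriv (a *: f) = a *: fps_deriv f.
Proof. by apply: fpsP => n /=; rewrite mulrnAr. Qed.

Lemma fps_derivMX f : fps_deriv (f * fpsX) = fps_deriv f * fpsX + f.
Proof.
apply: fpsP => n.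
rewrite -[LHS]/(fps_coef (f * fpsX) n.+1 *+ n.+1).
rewrite -[RHS]/(fps_coef (fps_deriv f * fpsX) n + fps_coef f n) !fps_coefMX.
by case: n => [|n]; rewrite ?add0r // -mulrSr.
Qed.

Lemma fps_derivMXn f k :
  fps_deriv (f * fpsX ^+ k) * fpsX =
  (fps_deriv f * fpsX) * fpsX ^+ k + (f * fpsX ^+ k) *+ k.
Proof.
elim: k => [|k IH]; first by rewrite !mulr1 addr0.
rewrite exprSr mulrA fps_derivMX mulrDl IH !mulrDl -!mulrA -addrA; congr (_ + _).
by rewrite mulrnAl mulrS addrC mulrA.
Qed.

End FormalPowerSeries.

(* O is isomorphic to R[[t]] by disk_coord, and K is the localization of O at
   the generator t of the maximal ideal (t): t becomes invertible in K, every
   element of K is a fraction f / t^n, and f / 1 = 0 only if t^n f = 0 for some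
   n. *)
Record formal_disk (R : comNzRingType) (O K : comAlgType R) := FormalDisk {
  disk_coord : {lrmorphism O -> fps R};
  disk_coord_inv : fps R -> O;
  disk_coordK : cancel disk_coord disk_coord_inv;
  disk_coord_invK : cancel disk_coord_inv disk_coord;
  disk_loc : {lrmorphism O -> K};
  disk_tinv : K;
  disk_tinvP : disk_loc (disk_coord_inv (fpsX R)) * disk_tinv = 1;
  disk_fracP : forall x : K,
    exists nf : nat * O, x = disk_loc nf.2 * disk_tinv ^+ nf.1;
  disk_loc_eq0 : forall f : O,
    disk_loc f = 0 -> exists n, disk_coord_inv (fpsX R) ^+ n * f = 0
}.

Section ResidueForm.
Variables (R : comNzRingType) (O K : comAlgType R) (D : formal_disk O K).

Let coord := disk_coord D.
Let loc := disk_loc D.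
Let tinv := disk_tinv D.

Definition disk_t : O := disk_coord_inv D (fpsX R).
Definition frac (x : K) : nat * O := projT1 (cid (disk_fracP D x)).

Definition Oderiv (f : O) : O := disk_coord_inv D (fps_deriv (disk_coord D f)).

(* ddt x and residue x are given by a fraction x = f / t^n; they do not depend
   on the choice of the fraction (ddtE, residueE).  The module of continuous
   differentials is K dt, with  dx = (ddt x) dt:
   ddt (f / t^n) = f' / t^n - n f / t^(n+1). *)
Definition ddt (x : K) : K :=
  let: (n, f) := frac x in
  disk_loc D (Oderiv f) * disk_tinv D ^+ n - (x * disk_tinv D) *+ n.

(* the coefficient of t^(-1) in x, that is, the residue of x dt *)
Definition residue (x : K) : R :=
  let: (n, f) := frac x in
  if n is m.+1 then fps_coef (disk_coord D f) m else 0.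

(* (f, g) = Res (g df) *)
Definition residue_form (f g : K) : R := residue (g * ddt f).

Lemma fracP x : x = loc (frac x).2 * tinv ^+ (frac x).1.
Proof. exact: (projT2 (cid (disk_fracP D x))). Qed.

Fact locD f g : loc (f + g) = loc f + loc g. Proof. exact: rmorphD. Qed.
Fact locM f g : loc (f * g) = loc f * loc g. Proof. exact: rmorphM. Qed.
Fact locMn f n : loc (f *+ n) = loc f *+ n. Proof. exact: rmorphMn. Qed.
Fact locP a f g : loc (a *: f + g) = a *: loc f + loc g.
Proof. exact: linearP. Qed.
Fact coordD f g : coord (f + g) = coord f + coord g. Proof. exact: rmorphD. Qed.
Fact coordM f g : coord (f * g) = coord f * coord g. Proof. exact: rmorphM. Qed.
Fact coordX f n : coord (f ^+ n) = coord f ^+ n. Proof. exact: rmorphXn. Qed.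
Fact coordMn f n : coord (f *+ n) = coord f *+ n. Proof. exact: rmorphMn. Qed.
Fact coordP a f g : coord (a *: f + g) = a *: coord f + coord g.
Proof. exact: linearP. Qed.

Lemma coord_t : coord disk_t = fpsX R.
Proof. exact: disk_coord_invK. Qed.

Lemma loc_tX n : loc (disk_t ^+ n) * tinv ^+ n = 1.
Proof. by rewrite rmorphXn -exprMn_comm ?disk_tinvP ?expr1n //; apply: mulrC. Qed.

Lemma loc_inj : injective loc.
Proof.
move=> f g fg; have /disk_loc_eq0[n] : loc (f - g) = 0 by rewrite rmorphB /= fg subrr.
rewrite -/disk_t mulrBr => /subr0_eq /(congr1 coord); rewrite !coordM coordX coord_t.
rewrite ![_ ^+ n * _]mulrC => /(@fps_mulIXn R n).
exact: (can_inj (disk_coordK D)).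
Qed.

Lemma frac_eq n f m g : loc f * tinv ^+ n = loc g * tinv ^+ m ->
  coord f * fpsX R ^+ m = coord g * fpsX R ^+ n.
Proof.
move=> E; rewrite -coord_t -!coordX -!coordM; congr (coord _).
apply: loc_inj; rewrite !locM.
rewrite -[loc f]mulr1 -(loc_tX n) -[loc g]mulr1 -(loc_tX m).
rewrite [loc (_ ^+ n) * _]mulrC [loc (_ ^+ m) * _]mulrC !mulrA E.
by rewrite -!mulrA; congr (_ * _); congr (_ * _); apply: mulrC.
Qed.

Lemma residueE n f :
  residue (loc f * tinv ^+ n) = if n is m.+1 then fps_coef (coord f) m else 0.
Proof.
rewrite /residue; case E: (frac _) => [m g].
have := fracP (loc f * tinv ^+ n); rewrite E /= => /frac_eq H.
have : fps_coef (coord f * fpsX R ^+ m) (n + m).-1 =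
       fps_coef (coord g * fpsX R ^+ n) (n + m).-1 by rewrite H.
rewrite !fps_coefMXn; case: n m {E H} => [|n] [|m] //=; rewrite ?addn0 ?add0n.
- by rewrite ltnS leqnn subn0.
- by rewrite ltnS leqnn subn0 => ->.
rewrite ltnNge leq_addl addnK /= addnS -addSn ltnNge leq_addr /= addKn.
by move=> ->.
Qed.

Lemma ddtE n f : ddt (loc f * tinv ^+ n) =
  loc (Oderiv f) * tinv ^+ n - (loc f * tinv ^+ n * tinv) *+ n.
Proof.
set x := _ * _; rewrite /ddt; case E: (frac _) => [m g].
have Ex : x = loc g * tinv ^+ m by have := fracP x; rewrite E.
have H := frac_eq Ex.
have dH : loc (Oderiv f) * tinv ^+ n + (x * tinv) *+ m =
          loc (Oderiv g) * tinv ^+ m + (x * tinv) *+ n.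
  have := congr1 (fun h => fps_deriv h * fpsX R) H; rewrite !fps_derivMXn.
  have derivK h : fps_deriv (coord h) = coord (Oderiv h).
    by rewrite /coord disk_coord_invK.
  rewrite !derivK -coord_t -!coordX -!coordM -!coordMn -!coordD.
  move=> /(can_inj (disk_coordK D)) /(congr1 loc).
  rewrite !locD !locMn !locM.
  move=> /(congr1 (fun y => y * (tinv ^+ n * tinv ^+ m * tinv))).
  have tt : loc disk_t * tinv = 1 := disk_tinvP D.
  have aux h i j : loc (Oderiv h) * loc disk_t * loc (disk_t ^+ i) *
      (tinv ^+ j * tinv ^+ i * tinv) = loc (Oderiv h) * tinv ^+ j.
    rewrite [tinv ^+ j * _]mulrC -!mulrA [loc (_ ^+ i) * _]mulrA loc_tX mul1r.
    by rewrite [tinv ^+ j * tinv]mulrC [loc disk_t * _]mulrA tt mul1r.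
  have aux' h i j : loc h * loc (disk_t ^+ i) * (tinv ^+ j * tinv ^+ i * tinv) =
      loc h * tinv ^+ j * tinv.
    rewrite [tinv ^+ j * _]mulrC -!mulrA [loc (_ ^+ i) * _]mulrA loc_tX mul1r.
    by [].
  rewrite !mulrDl !mulrnAl aux aux' [tinv ^+ n * _]mulrC aux aux'.
  by rewrite -/x -Ex.
by apply/eqP; rewrite subr_eq addrAC dH addrK.
Qed.

Lemma common_frac x y : exists n f g,
  x = loc f * tinv ^+ n /\ y = loc g * tinv ^+ n.
Proof.
case: (frac x) (fracP x) => n f /= ->; case: (frac y) (fracP y) => m g /= ->.
exists (n + m)%N, (f * disk_t ^+ m), (g * disk_t ^+ n).
rewrite !locM exprD; split.
  by rewrite [tinv ^+ n * _]mulrC -mulrA [loc (_ ^+ m) * _]mulrA loc_tX mul1r.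
by rewrite -mulrA [loc (_ ^+ n) * _]mulrA loc_tX mul1r.
Qed.

Lemma Oderiv_linear : linear Oderiv.
Proof.
move=> a f g; apply: (can_inj (disk_coordK D)).
rewrite -/coord coordP /Oderiv /coord !disk_coord_invK -/coord coordP.
by rewrite fps_derivD fps_derivZ.
Qed.

Lemma ddt_linear : linear ddt.
Proof.
move=> a x y; have [n [f [g [-> ->]]]] := common_frac x y.
have E : a *: (loc f * tinv ^+ n) + loc g * tinv ^+ n =
  loc (a *: f + g) * tinv ^+ n by rewrite locP mulrDl scalerAl.
rewrite {1}E !ddtE -E Oderiv_linear locP !mulrDl mulrnDl opprD.
by rewrite -!scalerAl scalerBr scalerMnr addrACA.
Qed.

Lemma residue_linear : linear (residue : K -> R^o).
Proof.
move=> a x y; have [n [f [g [-> ->]]]] := common_frac x y.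
have -> : a *: (loc f * tinv ^+ n) + loc g * tinv ^+ n =
  loc (a *: f + g) * tinv ^+ n by rewrite locP mulrDl scalerAl.
rewrite !residueE coordP; case: n => [|n] //=.
by rewrite scaler0 addr0.
Qed.

Lemma residue_form_linearl g : linear (residue_form^~ g : K -> R^o).
Proof.
move=> a x y; rewrite /residue_form ddt_linear mulrDr -scalerAr.
exact: residue_linear.
Qed.

Definition Osub : {pred K} := fun x => `[< exists f, x = disk_loc D f >].

Fact Osub_closed : submod_closed Osub.
Proof.
split=> [|a _ _ /asboolP[f ->] /asboolP[g ->]]; apply/asboolP.
  by exists 0; rewrite rmorph0.
by exists (a *: f + g); rewrite linearP.
Qed.
HB.instance Definition _ := GRing.isSubmodClosed.Build R K Osub Osub_closed.

(* m^n, the n-th power of the ideal m = (t) of O, as a subset of K; these are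
   the basic neighbourhoods of 0 for the m-adic topology of K. *)
Definition madic (n : nat) (x : K) : Prop :=
  exists f : O, x = disk_loc D (disk_t ^+ n * f).

Definition madic_continuous (h : K -> K) : Prop :=
  forall x n, exists m, forall y, madic m (y - x) -> madic n (h y - h x).

Definition is_derivation (h : K -> K) : Prop :=
  forall x y, h (x * y) = x * h y + y * h x.

Definition perp (A : submodClosed K) : {pred K} :=
  fun f => `[< forall a, a \in A -> residue_form f a = 0 >].

Fact perp_closed A : submod_closed (perp A).
Proof.
split=> [|a x y /asboolP Hx /asboolP Hy]; apply/asboolP => c Ac.
  have := residue_form_linearl c (-1) 0 0.
  by rewrite scaleN1r addNr => ->; rewrite scaleN1r addNr.
by rewrite residue_form_linearl Hx ?Hy ?scaler0 ?addr0.
Qed.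
HB.instance Definition _ A :=
  GRing.isSubmodClosed.Build R K (perp A) (perp_closed A).

Definition finite_type (A : subalgClosed K) : Prop :=
  exists s : seq K, {subset s <= A} /\
    forall B : subalgClosed K, {subset s <= B} -> {subset A <= B}.

Record fock_type (A : subalgClosed K) : Prop := FockType {
  ft_flat : flat (sub_lmod A);
  ft_finite_type : finite_type A;
  ft_cap : forall x : K, (x \in A) && (x \in Osub) <-> exists a : R, x = a%:A;
  ft_corank : exists d, free_of_rank (quot_lmod (sum_sub A Osub)) d;
  ft_isotropic : isotropic residue_form A;
  ft_deriv : forall h : {linear K -> K},
    is_derivation h -> madic_continuous h ->
    {in A, forall x, h x \in A} ->
    {in perp A, forall x, h x \in A}
}.

Section HA.
Variable A : submodClosed K.

Definition A_in_perp : {pred sub_lmod (perp A)} :=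
  preim_sub (val : {linear sub_lmod (perp A) -> K}) A.
HB.instance Definition _ := GRing.SubmodClosed.on A_in_perp.

Definition HA : lmodType R := quot_lmod A_in_perp.

Definition HA_class : {linear sub_lmod (perp A) -> HA} := @quot_pi _ _ A_in_perp.

(* (a1, a2)_A = Res (a2~ d a1~) for chosen lifts; changing a lift by an element
   of A changes nothing, since the lifts are orthogonal to A. *)
Definition HA_form (x y : HA) : R :=
  residue_form (val (quot_repr x)) (val (quot_repr y)).

(* the image of perp A :&: O in HA *)
Definition FA : {pred HA} :=
  im_sub HA_class (preim_sub (val : {linear sub_lmod (perp A) -> K}) Osub).
HB.instance Definition _ := GRing.SubmodClosed.on FA.

End HA.

End ResidueForm.

Arguments HA_form {R O K} D A _ _.
Arguments FA {R O K} D A _.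

(* Main.v *)
Require Import Defs.
From HB Require Import structures.
From mathcomp Require Import all_boot all_algebra.
From mathcomp Require Import boolp reals complex.
From mathcomp Require Import functions.

Set Implicit Arguments.
Unset Strict Implicit.
Unset Printing Implicit Defensive.

Import GRing.Theory.
Local Open Scope ring_scope.

(** Write [b] for the residue form, [P] for the orthogonal of [A], and [O] for
    the image of the disk algebra in [K].

    The linear algebra.  [O] is isotropic, and since integers are invertible
    every linear form on [K] that kills [O] is [b z] for some [z] in [O]: its
    coefficients are the values on the poles t^-k divided by k ([dual_repP]);
    [z] is unique up to a scalar ([form_radical]).  As [K/(A + O)] is free and
    [A] meets [O] only in the scalars, the linear form [b x] on [A] extends to a
    linear form on [K] that kills [O].  Representing the extension gives a
    linear map [q : K -> O] such that [x - q x] lies in [P] ([reg_rep_perp]);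
    in particular [K = P + O].  The coordinates of [K/(A + O)] are represented
    by elements of [P] in [O], the basis vectors have lifts in [P], and the
    classes of both families satisfy [b o_i o_j = 0], [b o_i e_j = delta_ij] and
    span [H = P/A].  This gives freeness, nondegeneracy and the maximality of
    the isotropic [F].

    The Fock modules.  Linear maps out of a Fock module are obtained from its
    universal property [fock_lift].  Since [A] is orthogonal to [P], operators
    from [P] act on the coinvariants of F(K, O) through [H], and [F] kills the
    vacuum class; hence the map Psi of the statement.  Its inverse is Wick's
    normal ordering.  To evaluate a word of F(K, O) in F(H, F), write each letter
    as [x = (x - q x) + q x], let [x - q x] in [P] act through [H], and move
    [q x] in [O] to the right, where it kills the vacuum, at the price of one
    contraction with each letter that it passes.  That this does not depend on
    the way a vector is written as a combination of words is again
    [fock_lift], once the recursion is organised as an action of [K]: a vector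
    [w] is represented by the function which sends a list [s] of elements of [O]
    to the normal ordering of [s o w], and the formula for the action
    ([wick_act]) only involves such functions.  The commutation relations hold
    on the functions that are symmetric and multilinear ([wick_rho_comm]).  The
    two composites are the identity because they are so on words. *)

(** * Linear and bilinear maps given as plain functions *)

Definition bilinear_form (R : comNzRingType) (M : lmodType R)
    (b : M -> M -> R) : Prop :=
  (forall y, linear (b^~ y : M -> R^o)) /\ (forall x, linear (b x : M -> R^o)).

Section LinearFacts.
Variables (R : comNzRingType) (V W : lmodType R) (f : V -> W).
Hypothesis fl : linear f.

Lemma linear_fun0 : f 0 = 0.
Proof. by have := fl (-1) 0 0; rewrite !scaleN1r !addNr. Qed.
Lemma linear_funD x y : f (x + y) = f x + f y.
Proof. by have := fl 1 x y; rewrite !scale1r. Qed.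
Lemma linear_funZ a x : f (a *: x) = a *: f x.
Proof. by have := fl a x 0; rewrite linear_fun0 !addr0. Qed.
Lemma linear_funN x : f (- x) = - f x.
Proof. by rewrite -[- x]scaleN1r linear_funZ scaleN1r. Qed.
Lemma linear_funB x y : f (x - y) = f x - f y.
Proof. by rewrite linear_funD linear_funN. Qed.
Lemma linear_fun_sum I (r : seq I) (F : I -> V) :
  f (\sum_(i <- r) F i) = \sum_(i <- r) f (F i).
Proof.
by elim: r => [|i r IH]; rewrite ?big_nil ?big_cons ?linear_fun0 // linear_funD IH.
Qed.
End LinearFacts.

Lemma submodB (R : nzRingType) (V : lmodType R) (S : submodClosed V) x y :
  x \in S -> y \in S -> x - y \in S.
Proof. by move=> Sx Sy; rewrite -scaleN1r rpredD ?rpredZ. Qed.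

Section BilinearFacts.
Variables (R : comNzRingType) (M : lmodType R) (b : M -> M -> R).
Hypothesis bb : bilinear_form b.

Lemma bform0l y : b 0 y = 0. Proof. exact: linear_fun0 (bb.1 y). Qed.
Lemma bform0r x : b x 0 = 0. Proof. exact: linear_fun0 (bb.2 x). Qed.
Lemma bformDl x x' y : b (x + x') y = b x y + b x' y.
Proof. exact: linear_funD (bb.1 y) x x'. Qed.
Lemma bformDr x y y' : b x (y + y') = b x y + b x y'.
Proof. exact: linear_funD (bb.2 x) y y'. Qed.
Lemma bformBl x x' y : b (x - x') y = b x y - b x' y.
Proof. exact: linear_funB (bb.1 y) x x'. Qed.
Lemma bformBr x y y' : b x (y - y') = b x y - b x y'.
Proof. exact: linear_funB (bb.2 x) y y'. Qed.
Lemma bformZl a x y : b (a *: x) y = a * b x y.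
Proof. exact: linear_funZ (bb.1 y) a x. Qed.
Lemma bformZr a x y : b x (a *: y) = a * b x y.
Proof. exact: linear_funZ (bb.2 x) a y. Qed.
Lemma bform_suml I (r : seq I) (F : I -> M) y :
  b (\sum_(i <- r) F i) y = \sum_(i <- r) b (F i) y.
Proof.
by elim: r => [|i r IH]; rewrite ?big_nil ?big_cons ?bform0l // bformDl IH.
Qed.
Lemma bform_sumr I (r : seq I) (F : I -> M) x :
  b x (\sum_(i <- r) F i) = \sum_(i <- r) b x (F i).
Proof.
by elim: r => [|i r IH]; rewrite ?big_nil ?big_cons ?bform0r // bformDr IH.
Qed.
End BilinearFacts.

(** * Fock modules and their universal property *)

Section TensorFacts.
Variables (R : comNzRingType) (X Y : lmodType R) (S : Type).
Variables (ra : X -> S -> X) (la : S -> Y -> Y).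

Lemma tensor_ind (P : tensor ra la -> Prop) :
    (forall x y, P (tpure ra la x y)) ->
    (forall u v, P u -> P v -> P (u + v)) ->
    (forall a u, P u -> P (a *: u)) ->
  forall u, P u.
Proof.
move=> Pp PD PZ u; rewrite -[u]treprK; elim: (trepr u) => {u} [x y||u Pu v Pv|u Pu|a u Pu].
- exact: Pp.
- by rewrite -[tclass _ _ _]/(0 : tensor ra la) -(scale0r (tpure ra la 0 0)); apply: PZ.
- by rewrite tclassD; apply: PD.
- rewrite tclassN -[tensor_opp _]/(- (tclass ra la u : tensor ra la)) -scaleN1r.
  exact: PZ.
- by rewrite tclassZ; apply: PZ.
Qed.

Lemma tpureDl x x' y : tpure ra la (x + x') y = tpure ra la x y + tpure ra la x' y.
Proof. by rewrite -[RHS]tclassD; apply/tclassP/teq_pureDl. Qed.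
Lemma tpureZl a x y : tpure ra la (a *: x) y = a *: tpure ra la x y.
Proof. by rewrite -[RHS]tclassZ; apply/tclassP/teq_pureZl. Qed.
Lemma tpureZr a x y : tpure ra la x (a *: y) = a *: tpure ra la x y.
Proof. by rewrite -[RHS]tclassZ; apply/tclassP/teq_pureZr. Qed.
Lemma tpure_balanced x s y : tpure ra la (ra x s) y = tpure ra la x (la s y).
Proof. exact/tclassP/teq_balanced. Qed.
End TensorFacts.

Lemma uenv_ind (R : comNzRingType) (L : lmodType R) (br : L -> L -> L)
    (P : uenv br -> Prop) :
    (forall x, P (ugen br x)) -> P 1 ->
    (forall u v, P u -> P v -> P (u + v)) ->
    (forall u v, P u -> P v -> P (u * v)) ->
    (forall a u, P u -> P (a *: u)) ->
  forall u, P u.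
Proof.
move=> Pg P1 PD PM PZ u; rewrite -[u]ureprK.
elim: (urepr u) => {u} [x|||u Pu v Pv|u Pu|u Pu v Pv|a u Pu].
- exact: Pg.
- by rewrite -[uclass _ _]/(0 : uenv br) -(scale0r 1); apply: PZ.
- exact: P1.
- by rewrite uclassD; apply: PD.
- by rewrite uclassN -[uenv_opp _]/(- (uclass br u : uenv br)) -scaleN1r; apply: PZ.
- by rewrite uclassM; apply: PM.
- by rewrite uclassZ; apply: PZ.
Qed.

Section FockModule.
Variables (R : comNzRingType) (M : lmodType R) (b : M -> M -> R).
Variable F : submodClosed M.
Hypotheses (bb : bilinear_form b) (bF : isotropic b F).

Local Notation fock := (fock b F).
Local Notation U := (Uhat b).

Lemma fock_act_pure (u u' : U) (r : R^o) :
  fock_act u (tpure _ _ u' r : fock) = tpure _ _ (u * u') r.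
Proof. exact: (tlift_pure (fock_act_compat F u)). Qed.

Let act_lin (u : U) := @fock_act_linear R M b F u.

Lemma fock_actM (u v : U) (w : fock) : fock_act (u * v) w = fock_act u (fock_act v w).
Proof.
elim/tensor_ind: w => [u' r|w w' IH IH'|a w IH].
- by rewrite !fock_act_pure mulrA.
- by rewrite !(linear_funD (act_lin _)) IH IH'.
- by rewrite !(linear_funZ (act_lin _)) IH.
Qed.

Lemma fock_act1 (w : fock) : fock_act (1 : U) w = w.
Proof.
elim/tensor_ind: w => [u' r|w w' IH IH'|a w IH].
- by rewrite fock_act_pure mul1r.
- by rewrite !(linear_funD (act_lin _)) IH IH'.
- by rewrite !(linear_funZ (act_lin _)) IH.
Qed.

Lemma fock_actDl (u v : U) (w : fock) : fock_act (u + v) w = fock_act u w + fock_act v w.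
Proof.
elim/tensor_ind: w => [u' r|w w' IH IH'|a w IH].
- by rewrite !fock_act_pure mulrDl tpureDl.
- by rewrite !(linear_funD (act_lin _)) IH IH' addrACA.
- by rewrite !(linear_funZ (act_lin _)) IH scalerDr.
Qed.

Lemma fock_actZl a (u : U) (w : fock) : fock_act (a *: u) w = a *: fock_act u w.
Proof.
elim/tensor_ind: w => [u' r|w w' IH IH'|c w IH].
- by rewrite !fock_act_pure -scalerAl tpureZl.
- by rewrite !(linear_funD (act_lin _)) IH IH' scalerDr.
- by rewrite !(linear_funZ (act_lin _)) IH !scalerA mulrC.
Qed.

Let hatF_incl_linear :
  linear (fun x : hat (sub_lmod F) => ugen (hat_bracket b) (val x.1, x.2)).
Proof. by move=> a x y; rewrite -ugen_linear. Qed.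

Let hatF_incl_bracket (x y : hat (sub_lmod F)) :
  let g z := ugen (hat_bracket b) (val z.1, z.2) in
  g (hat_bracket (sub_form b (F := F)) x y) = g x * g y - g y * g x.
Proof. by rewrite /= ugen_bracket. Qed.

Lemma Uhat_inclP : [/\ linear (@Uhat_incl R M b F),
   monoid_morphism (@Uhat_incl R M b F)
 & forall x, Uhat_incl (ugen (hat_bracket (sub_form b (F := F))) x) = ugen (hat_bracket b) (val x.1, x.2)].
Proof. exact: (uliftP hatF_incl_linear hatF_incl_bracket). Qed.

Lemma Uhat_charP : [/\ linear (@Uhat_char R M b F),
   monoid_morphism (@Uhat_char R M b F : _ -> R^o)
 & forall x, Uhat_char (ugen (hat_bracket (sub_form b (F := F))) x) = x.2].
Proof.
apply: uliftP => [//|x y].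
by rewrite /= /sub_form bF ?(valP x.1) ?(valP y.1) // mulrC subrr.
Qed.

(** The central element hbar commutes with the enveloping algebra, so it can be
    moved through the tensor sign, where its character is 1. *)
Lemma fock_act_hbar (w : fock) : fock_act (ugen (hat_bracket b) (0, 1)) w = w.
Proof.
have [_ _ inclE] := Uhat_inclP; have [_ _ charE] := Uhat_charP.
elim/tensor_ind: w => [u r|w w' IH IH'|a w IH].
- pose h : Uhat_sub b F := ugen _ (0, 1).
  have hE : Uhat_incl h = ugen (hat_bracket b) (0, 1) by rewrite inclE.
  have hu : ugen (hat_bracket b) (0, 1) * u = u * Uhat_incl h.
    rewrite hE; elim/uenv_ind: u => [x||u v IHu IHv|u v IHu IHv|a u IHu].
    + apply/eqP; rewrite -subr_eq0 ugen_bracket /hat_bracket /= (bform0l bb).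
      by rewrite (linear_fun0 (@ugen_linear _ _ _)).
    + by rewrite mul1r mulr1.
    + by rewrite mulrDl mulrDr IHu IHv.
    + by rewrite mulrA IHu -!mulrA IHv.
    + by rewrite -scalerAr -scalerAl IHu.
  rewrite fock_act_pure hu.
  by rewrite (tpure_balanced (fun (u : U) s => u * Uhat_incl s)) charE mul1r.
- by rewrite !(linear_funD (act_lin _)) IH IH'.
- by rewrite !(linear_funZ (act_lin _)) IH.
Qed.

Lemma fock_act_gen x r (w : fock) :
  fock_act (ugen (hat_bracket b) (x, r)) w = fock_op x w + r *: w.
Proof.
have -> : (x, r) = (x, 0) + r *: (0, 1) :> hat M.
  by congr pair => /=; rewrite ?scaler0 ?addr0 // add0r /GRing.scale /= mulr1.
rewrite (linear_funD (@ugen_linear _ _ _)) (linear_funZ (@ugen_linear _ _ _)).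
by rewrite fock_actDl fock_actZl fock_act_hbar.
Qed.

Lemma fock_op_linear x : linear (@fock_op R M b F x).
Proof. exact: fock_act_linear. Qed.

Lemma fock_op_linearl (w : fock) : linear (fun x => fock_op x w).
Proof.
move=> a x y; rewrite /fock_op -fock_actZl -fock_actDl; congr fock_act.
rewrite -ugen_linear; congr ugen.
by congr pair => /=; rewrite /GRing.scale /= ?mulr0 addr0.
Qed.

Lemma fock_op_comm x y (w : fock) :
  fock_op x (fock_op y w) - fock_op y (fock_op x w) = b x y *: w.
Proof.
rewrite /fock_op -!fock_actM -[- fock_act _ _]scaleN1r -fock_actZl -fock_actDl.
by rewrite scaleN1r ugen_bracket fock_act_gen
  (linear_fun0 (fock_op_linearl w)) add0r.
Qed.

Lemma fock_op_vacuum x : x \in F -> fock_op x (vacuum b F) = 0.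
Proof.
move=> Fx; have [_ _ inclE] := Uhat_inclP; have [_ _ charE] := Uhat_charP.
pose x' : sub_lmod F := Sub x Fx.
pose h : Uhat_sub b F := ugen _ (x', 0).
have hE : Uhat_incl h = hat_incl b x by rewrite inclE.
rewrite /fock_op /vacuum fock_act_pure mulr1 -hE -[Uhat_incl h]mul1r.
rewrite (tpure_balanced (fun (u : U) s => u * Uhat_incl s)) charE mul0r.
by rewrite -(scale0r (1 : R^o)) tpureZr scale0r.
Qed.

(** Words span: the vacuum generates the module over the enveloping algebra, and
    the algebra is generated by [M] together with hbar, which acts as 1. *)
Lemma fock_word_ind (P : fock -> Prop) :
    (forall xs, P (fock_word b F xs)) -> (forall u v, P u -> P v -> P (u + v)) ->
    (forall a u, P u -> P (a *: u)) ->
  forall w, P w.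
Proof.
move=> Pw PD PZ w.
(* The span of the words, given as the intersection of all such P, is stable
   under every generator and hence under the enveloping algebra. *)
pose span w := forall Q : fock -> Prop, (forall xs, Q (fock_word b F xs)) ->
  (forall u v, Q u -> Q v -> Q (u + v)) -> (forall a u, Q u -> Q (a *: u)) -> Q w.
have spanw xs : span (fock_word b F xs) by move=> Q Qw _ _; apply: Qw.
have spanD u v : span u -> span v -> span (u + v).
  by move=> su sv Q Qw QD QZ; exact: (QD _ _ (su Q Qw QD QZ) (sv Q Qw QD QZ)).
have spanZ a u : span u -> span (a *: u).
  by move=> su Q Qw QD QZ; exact: (QZ _ _ (su Q Qw QD QZ)).
suff sw : span w by exact: sw Pw PD PZ.
elim/tensor_ind: w => [u r|//|//].
have -> : tpure _ _ u r = r *: fock_act u (vacuum b F).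
  rewrite /vacuum fock_act_pure mulr1.
  have {1}<- : (r : R) *: (1 : R^o) = r by rewrite /GRing.scale /= mulr1.
  exact: tpureZr.
apply: (spanZ); have : span (vacuum b F) := spanw [::].
elim/uenv_ind: u (vacuum b F) => [[x a]||u v IHu IHv|u v IHu IHv|a u IHu] w sw.
- rewrite fock_act_gen; apply: (spanD); last exact: spanZ.
  apply: (sw (fun w => span (fock_op x w))) => [xs|u v su sv|c u su].
  + exact: (spanw (x :: xs)).
  + by rewrite (linear_funD (fock_op_linear x)); apply: (spanD).
  + by rewrite (linear_funZ (fock_op_linear x)); apply: (spanZ).
- by rewrite fock_act1.
- by rewrite fock_actDl; exact: (spanD _ _ (IHu w sw) (IHv w sw)).
- by rewrite fock_actM; exact: (IHu _ (IHv w sw)).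
- by rewrite fock_actZl; exact: (spanZ _ _ (IHu w sw)).
Qed.

Lemma fock_linear_ext (X : lmodType R) (f g : fock -> X) :
    linear f -> linear g ->
    (forall xs, f (fock_word b F xs) = g (fock_word b F xs)) ->
  f =1 g.
Proof.
move=> fl gl fg; apply: fock_word_ind => [//|u v fu fv|a u fu].
  by rewrite (linear_funD fl) (linear_funD gl) fu fv.
by rewrite (linear_funZ fl) (linear_funZ gl) fu.
Qed.

Section Universal.
Variables (X : lmodType R) (rho : M -> X -> X) (x0 : X).
Hypotheses (rho_linear : forall x, linear (rho x))
  (rho_linearl : forall v, linear (rho^~ v))
  (rho_comm : forall x y v, rho x (rho y v) - rho y (rho x v) = b x y *: v)
  (rho_x0 : forall x, x \in F -> rho x x0 = 0).

Fixpoint uact (u : uterm (hat M)) (v : X) : X :=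
  match u with
  | UGen x => rho x.1 v + x.2 *: v
  | UZero => 0
  | UOne => v
  | UAdd u u' => uact u v + uact u' v
  | UOpp u => - uact u v
  | UMul u u' => uact u (uact u' v)
  | UScale a u => a *: uact u v
  end.

Lemma uact_linear u : linear (uact u).
Proof.
elim: u => [x|||u IHu u' IHu'|u IHu|u IHu u' IHu'|c u IHu] a v w //=.
- by rewrite rho_linear !scalerDr !scalerA [x.2 * a]mulrC addrACA.
- by rewrite scaler0 addr0.
- by rewrite IHu IHu' !scalerDr addrACA.
- by rewrite IHu opprD scalerN.
- by rewrite IHu' IHu.
- by rewrite IHu scalerDr !scalerA mulrC.
Qed.

Lemma uact_eq u v : ueq (hat_bracket b) u v -> uact u =1 uact v.
Proof.
elim=> {u v} //=.
- by move=> u v _ IH w; rewrite IH.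
- by move=> v u w _ IH _ IH' x; rewrite IH IH'.
- by move=> u u' v v' _ IH _ IH' x; rewrite IH IH'.
- by move=> u u' _ IH x; rewrite IH.
- by move=> u u' v v' _ IH _ IH' x; rewrite IH IH'.
- by move=> a u u' _ IH x; rewrite IH.
- by move=> u v w x; rewrite addrA.
- by move=> u v x; rewrite addrC.
- by move=> u x; rewrite add0r.
- by move=> u x; rewrite addNr.
- by move=> u v w x; rewrite (linear_funD (uact_linear u)).
- by move=> a c u x; rewrite scalerA.
- by move=> u x; rewrite scale1r.
- by move=> a u v x; rewrite scalerDr.
- by move=> u a c x; rewrite scalerDl.
- by move=> a u v x; rewrite (linear_funZ (uact_linear u)).
- by move=> x y v; rewrite (linear_funD (rho_linearl v)) scalerDl addrACA.
- by move=> a x v; rewrite (linear_funZ (rho_linearl v)) scalerDr scalerA.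
move=> x y v; rewrite (linear_fun0 (rho_linearl v)) add0r -rho_comm.
rewrite !(linear_funD (rho_linear _)) !(linear_funZ (rho_linear _)) !scalerDr.
rewrite !scalerA [y.2 * _]mulrC.
have cancel4 (p q r s p' : X) : p + q + (r + s) - (p' + r + (q + s)) = p - p'.
  by rewrite -(addrA p) -(addrA p') (addrCA r) opprD addrACA subrr addr0.
exact: cancel4.
Qed.

(** [fock_lift] is stated for a bare action [rho] of [M], so the module structure
    over the enveloping algebra is recovered here from representatives;
    [uact_eq] makes it independent of them. *)
Definition uenv_act (u : U) : X -> X := uact (urepr u).

Let uenv_actE u : uenv_act (uclass _ u) =1 uact u.
Proof. exact/uact_eq/ucanon. Qed.

Lemma uenv_act_linear u : linear (uenv_act u).
Proof. exact: uact_linear. Qed.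
Lemma uenv_act_gen x v : uenv_act (ugen _ x) v = rho x.1 v + x.2 *: v.
Proof. exact: uenv_actE. Qed.
Lemma uenv_act1 v : uenv_act 1 v = v.
Proof. exact: (uenv_actE (UOne _)). Qed.
Lemma uenv_actD u u' v : uenv_act (u + u') v = uenv_act u v + uenv_act u' v.
Proof. by rewrite -{1}[u]ureprK -{1}[u']ureprK -[_ + _]uclassD uenv_actE. Qed.
Lemma uenv_actM u u' v : uenv_act (u * u') v = uenv_act u (uenv_act u' v).
Proof. by rewrite -{1}[u]ureprK -{1}[u']ureprK -[_ * _]uclassM uenv_actE. Qed.
Lemma uenv_actZ a u v : uenv_act (a *: u) v = a *: uenv_act u v.
Proof. by rewrite -{1}[u]ureprK -[_ *: _]uclassZ uenv_actE. Qed.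

(** Both sides are multiplicative in [s]: this is the balancing condition that
    lets the action on [x0] descend to the tensor product. *)
Lemma uenv_act_incl (s : Uhat_sub b F) :
  uenv_act (Uhat_incl s) x0 = (Uhat_char s : R) *: x0.
Proof.
have [incl_lin [incl1 inclM] inclE] := Uhat_inclP.
have [char_lin [char1 charM] charE] := Uhat_charP.
elim/uenv_ind: s => [x||u v IHu IHv|u v IHu IHv|a u IHu].
- by rewrite inclE charE uenv_act_gen /= rho_x0 ?add0r // (valP x.1).
- by rewrite incl1 char1 uenv_act1 scale1r.
- by rewrite (linear_funD incl_lin) (linear_funD char_lin) uenv_actD IHu IHv scalerDl.
- rewrite inclM charM uenv_actM IHv (linear_funZ (uenv_act_linear _)).
  by rewrite IHu scalerA mulrC.
- by rewrite (linear_funZ incl_lin) (linear_funZ char_lin) uenv_actZ IHu scalerA.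
Qed.

(** The Fock module is induced from the character of [F + R hbar]: an action of
    [M] in which hbar is 1, together with a vector killed by [F], receives an
    equivariant map from it. *)
Lemma fock_lift : exists f : {linear fock -> X},
  forall xs, f (fock_word b F xs) = foldr rho x0 xs.
Proof.
pose h (u : U) (r : R^o) := (r : R) *: uenv_act u x0.
have hP : tensor_compat (fun (u : U) (s : Uhat_sub b F) => u * Uhat_incl s)
    (fun (s : Uhat_sub b F) (r : R^o) => Uhat_char s * r) h.
  split=> [r a u v|u a r r'|u s r]; rewrite /h.
  - by rewrite uenv_actD uenv_actZ scalerDr !scalerA mulrC.
  - by rewrite scalerDl scalerA.
  - rewrite uenv_actM uenv_act_incl (linear_funZ (uenv_act_linear _)) scalerA.
    by rewrite mulrC.
have fl := tlift_linear hP.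
pose lf := GRing.isLinear.Build R fock X *:%R (tlift h) fl.
pose f : {linear fock -> X} := HB.pack (tlift h) lf.
exists f.
have actE u (w : fock) : f (fock_act u w) = uenv_act u (f w).
  elim/tensor_ind: w => [u' r|w w' IH IH'|a w IH].
  - rewrite fock_act_pure /= !(tlift_pure hP) /h uenv_actM.
    by rewrite (linear_funZ (uenv_act_linear _)).
  - by rewrite (linear_funD (act_lin _)) !linearD IH IH'
      (linear_funD (uenv_act_linear _)).
  - by rewrite (linear_funZ (act_lin _)) !linearZ_LR IH
      (linear_funZ (uenv_act_linear _)).
elim=> [|x xs IH].
  by rewrite /= (tlift_pure hP) /h uenv_act1 scale1r.
rewrite -[fock_word _ _ _]/(fock_act (hat_incl b x) (fock_word b F xs)).
by rewrite actE uenv_act_gen IH /= scale0r addr0.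
Qed.
End Universal.
End FockModule.

(** * Contractions of a list of vectors *)

Section Contraction.
Variables (R : comNzRingType) (M : lmodType R) (b : M -> M -> R).
Variable O : submodClosed M.
Hypothesis bb : bilinear_form b.

Local Notation T := (sub_lmod O).

(** The terms that arise when [x] moves to the left across the entries of [s]:
    each entry that it passes is contracted with it and disappears from [s]. *)
Fixpoint contract (X : lmodType R) (f : seq T -> X) (x : M) (s : seq T) : X :=
  if s is o :: s' then b (val o) x *: f s' + contract (fun r => f (o :: r)) x s'
  else 0.

Section Values.
Variable X : lmodType R.
Implicit Types (f g : seq T -> X) (x y : M) (s : seq T).

Lemma eq_contract f g x s : f =1 g -> contract f x s = contract g x s.
Proof. by move=> /funext ->. Qed.

Lemma contract_linear a f g x s :
  contract (fun r => a *: f r + g r) x s = a *: contract f x s + contract g x s.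
Proof.
elim: s f g => [|o s IH] f g /=; first by rewrite scaler0 addr0.
by rewrite IH !scalerDr !scalerA mulrC addrACA.
Qed.

Lemma contractD f g x s :
  contract (fun r => f r + g r) x s = contract f x s + contract g x s.
Proof.
have := contract_linear 1 f g x s; rewrite scale1r => <-.
by apply: eq_contract => r; rewrite scale1r.
Qed.

Lemma contract_linear_vector f s : linear (fun x => contract f x s).
Proof.
move=> a x y; elim: s f => [|o s IH] f /=; first by rewrite scaler0 addr0.
by rewrite IH bformDr // bformZr // scalerDl scalerDr scalerA addrACA.
Qed.

(** Both sides are the sum over the ordered pairs of distinct entries of [s], one
    contracted with [x] and the other with [y]. *)
Lemma contract_comm f x y s :
  contract (contract f y) x s = contract (contract f x) y s.
Proof.
elim: s f => [//|o s IH] f /=.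
rewrite (contract_linear _ f (fun r => contract (fun r => f (o :: r)) y r)).
rewrite (contract_linear _ f (fun r => contract (fun r => f (o :: r)) x r)).
by rewrite IH addrCA.
Qed.

Definition swap_invariant f := forall s1 o o' s2,
  f (s1 ++ [:: o, o' & s2]) = f (s1 ++ [:: o', o & s2]).

Definition multilinear f := forall s1 s2, linear (fun o => f (s1 ++ o :: s2)).

Lemma swap_invariant_cons f o :
  swap_invariant f -> swap_invariant (fun r => f (o :: r)).
Proof. by move=> fs s1; apply: (fs (o :: s1)). Qed.

Lemma multilinear_cons f o : multilinear f -> multilinear (fun r => f (o :: r)).
Proof. by move=> fm s1; apply: (fm (o :: s1)). Qed.

Lemma swap_invariant_contract f x :
  swap_invariant f -> swap_invariant (contract f x).
Proof.
move=> fs s1; elim: s1 f fs => [|o1 s1 IH] f fs o o' s2 /=.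
  rewrite addrCA; congr (_ + (_ + _)); apply: eq_contract => r.
  exact: (fs [::]).
by rewrite fs (IH _ (swap_invariant_cons o1 fs)).
Qed.

Lemma multilinear_contract f x : multilinear f -> multilinear (contract f x).
Proof.
move=> fm s1; elim: s1 f fm => [|o1 s1 IH] f fm s2 a o o' /=.
  have -> : (fun r => f (a *: o + o' :: r)) =
            (fun r => a *: f (o :: r) + f (o' :: r)).
    by apply: funext => r; apply: (fm [::] r).
  rewrite contract_linear bformDl // bformZl //.
  by rewrite scalerDl scalerDr scalerA addrACA.
rewrite fm (IH _ (multilinear_cons o1 fm)).
by rewrite !scalerDr !scalerA mulrC addrACA.
Qed.

End Values.

Lemma linear_contract (X Y : lmodType R) (g : X -> Y) (f : seq T -> X) x s :
  linear g -> g (contract f x s) = contract (fun r => g (f r)) x s.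
Proof.
move=> gl; elim: s f => [|o s IH] f /=; first exact: linear_fun0.
by rewrite (linear_funD gl) (linear_funZ gl) IH.
Qed.

End Contraction.

Lemma linear_comb_add3 (R : comNzRingType) (V : lmodType R) (a : R)
    (u u' v v' w w' : V) :
  a *: u + u' + (a *: v + v') + (a *: w + w') = a *: (u + v + w) + (u' + v' + w').
Proof. by rewrite [X in X + (_ + _)]addrACA [LHS]addrACA !scalerDr. Qed.

(** * Normal ordering and the reduction of Fock modules *)

(** The setting is a symplectic reduction.  [P] stands for the orthogonal of [A],
    [pi] for the projection of [P] on [P/A], and [q] for a linear map into the
    isotropic submodule [O] which moves every vector into [P]. *)
Section Wick.
Variables (R : comNzRingType) (M H : lmodType R).
Variables (b : M -> M -> R) (c : H -> H -> R).
Variables (O P : submodClosed M) (F : submodClosed H).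
Variable pi : {linear sub_lmod P -> H}.
Variable q : {linear M -> M}.
Hypotheses (bb : bilinear_form b) (bc : bilinear_form c).
Hypotheses (b_anti : forall x y, b x y = - b y x) (bO : isotropic b O)
  (cF : isotropic c F).
Hypotheses (pi_form : forall x y, c (pi x) (pi y) = b (val x) (val y))
  (piF : forall x, val x \in O -> pi x \in F).
Hypotheses (qO : forall x, q x \in O) (qP : forall x, x - q x \in P).

Local Notation T := (sub_lmod O).
Local Notation V := (fock c F).

Definition reg_part (x : M) : T := Sub (q x) (qO x).
Definition red_part (x : M) : sub_lmod P := Sub (x - q x) (qP x).

Lemma reg_part_linear : linear reg_part.
Proof. by move=> a x y; apply: val_inj; rewrite /= linearP. Qed.

Lemma red_part_linear : linear red_part.
Proof.
move=> a x y; apply: val_inj; rewrite /= linearP scalerBr.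
by rewrite opprD addrACA.
Qed.

Let op_lin y := @fock_op_linear R H c F y.

(** An element of both [P] and [O] acts on a normally ordered vector in two ways,
    through [pi] or as a further entry of the list; the two have to agree. *)
Definition reduced_equivariant (f : seq T -> V) := forall (o : T) (y : sub_lmod P) s,
  val o = val y -> f (o :: s) = fock_op (pi y) (f s).

Definition wick_fun : {pred seq T -> V} := fun f =>
  `[< [/\ swap_invariant f, multilinear f & reduced_equivariant f] >].

Fact wick_fun_closed : submod_closed wick_fun.
Proof.
split=> [|a f g /asboolP[fs fm fe] /asboolP[gs gm ge]]; apply/asboolP.
  split=> // [s1 s2 a o o'|o y s _]; first by rewrite /= scaler0 addr0.
  by rewrite [RHS](linear_fun0 (op_lin _)).
split=> [s1 o o' s2|s1 s2 d o o'|o y s oy]; rewrite !fctE.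
- by rewrite fs gs.
- by rewrite fm gm !scalerDr !scalerA mulrC addrACA.
- by rewrite (fe _ _ _ oy) (ge _ _ _ oy) op_lin.
Qed.
HB.instance Definition _ :=
  GRing.isSubmodClosed.Build R (seq T -> V) wick_fun wick_fun_closed.

(** If [f s] is the normal ordering of [s o w], this is that of [s o (x o w)]: [x]
    is moved to the left of [s], which costs the contractions, and then split
    into its two parts. *)
Definition wick_act (x : M) (f : seq T -> V) : seq T -> V := fun s =>
  fock_op (pi (red_part x)) (f s) + f (reg_part x :: s) + contract b f x s.

Lemma wick_act_closed x f : f \in wick_fun -> wick_act x f \in wick_fun.
Proof.
move=> /asboolP[fs fm fe]; apply/asboolP; split.
- move=> s1 o o' s2; rewrite /wick_act fs (fs (_ :: s1)).
  by rewrite (swap_invariant_contract b x fs).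
- move=> s1 s2 a o o'; rewrite /wick_act fm op_lin (fm (_ :: s1)).
  by rewrite (multilinear_contract bb) // linear_comb_add3.
- move=> o y s oy; rewrite /wick_act /=.
  rewrite (fs [::]) /= !(fe _ _ _ oy) !(linear_funD (op_lin _)).
  have -> : (fun r => f (o :: r)) = (fun r => fock_op (pi y) (f r)).
    by apply: funext => r; apply: fe.
  rewrite -(linear_contract _ _ _ _ (op_lin _)) addrA; congr (_ + _).
  rewrite addrAC; congr (_ + _); apply/eqP; rewrite -subr_eq0 addrAC.
  have := fock_op_comm bc cF (pi (red_part x)) (pi y) (f s) => ->.
  rewrite -scalerDl pi_form -oy bformBl // (b_anti (q x)) (bO (valP o) (qO x)).
  by rewrite oppr0 subr0 b_anti addNr scale0r.
Qed.

Definition wick_rho (x : M) (f : sub_lmod wick_fun) : sub_lmod wick_fun :=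
  Sub (wick_act x (val f)) (wick_act_closed x (valP f)).

Lemma wick_rho_linear x : linear (wick_rho x).
Proof.
move=> a f g; apply: val_inj; apply: funext => s.
rewrite /= /wick_act /= !fctE op_lin (contract_linear _ a (val f) (val g)).
exact: linear_comb_add3.
Qed.

Lemma wick_rho_linearl f : linear (wick_rho^~ f).
Proof.
have /asboolP[_ fm _] := valP f.
move=> a x y; apply: val_inj; apply: funext => s /=.
rewrite /wick_act !fctE red_part_linear linearP (fock_op_linearl _).
rewrite reg_part_linear (fm [::]) (contract_linear_vector bb).
exact: linear_comb_add3.
Qed.

(** In [wick_act x (wick_act y g)], every term is symmetric in [x] and [y] except
    the two collected in [E]; that of the two entries added to the list is
    symmetric because [g] is invariant under swaps. *)
Lemma wick_rho_comm x y f :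
  wick_rho x (wick_rho y f) - wick_rho y (wick_rho x f) = b x y *: f.
Proof.
case: f => g gW; have /asboolP[gs _ _] := gW.
apply: val_inj; apply: funext => s; rewrite /= !fctE.
(* A and B collect the terms whose sum is symmetric in x and y. *)
pose A x y := fock_op (pi (red_part x)) (g (reg_part y :: s))
  + contract b (fun r => g (reg_part x :: r)) y s
  + fock_op (pi (red_part x)) (contract b g y s).
pose B x y := g [:: reg_part y, reg_part x & s] + contract b (contract b g y) x s.
pose E x y := fock_op (pi (red_part x)) (fock_op (pi (red_part y)) (g s))
  + b (q x) y *: g s.
have actE x' y' : wick_act x' (wick_act y' g) s =
    E x' y' + (A x' y' + A y' x' + B x' y').
  rewrite {1}/wick_act {1 2}/wick_act /=.
  rewrite !(linear_funD (op_lin _)).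
  rewrite [contract b (wick_act _ _) _ _](contractD _
    (fun r => fock_op _ (g r) + g (_ :: r)) (contract b g y')).
  rewrite (contractD _ (fun r => fock_op _ (g r))).
  rewrite -(linear_contract _ _ _ _ (op_lin _)).
  rewrite /E /A /B.
  by rewrite [LHS](AC (3*(2*2)*3) ((1*6)*((2*7*3)*(4*9*8)*(5*10)))).
have Bsym : B x y = B y x by rewrite /B (gs [::] _ _ s : g [:: _, _ & _] = _) (contract_comm _ g).
rewrite !actE Bsym (addrC (A y x)) opprD addrACA subrr addr0 /E opprD addrACA.
rewrite (fock_op_comm bc cF) -scalerBl -scalerDl pi_form; congr (_ *: _).
rewrite /= bformBl // !bformBr // (bO (qO x) (qO y)) subr0 (b_anti x (q y)).
by rewrite opprK addrA subrK addrK.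
Qed.

Definition wick_vacuum_fun (s : seq T) : V := if s is [::] then vacuum c F else 0.

Lemma wick_vacuum_closed : wick_vacuum_fun \in wick_fun.
Proof.
apply/asboolP; split=> [[|? ?] o o' s2|[|? ?] s2 a o o'|o y s oy] //=;
  rewrite ?scaler0 ?addr0 //.
case: s => [|o1 s] /=; last by rewrite (linear_fun0 (op_lin _)).
by rewrite (fock_op_vacuum cF) // piF // -oy (valP o).
Qed.

Definition wick_vacuum : sub_lmod wick_fun := Sub wick_vacuum_fun wick_vacuum_closed.

(** The part [x - q x] of an element of [O] lies in both [P] and [O], so its
    projection is in [F] and kills the vacuum. *)
Lemma wick_rho_vacuum x : x \in O -> wick_rho x wick_vacuum = 0.
Proof.
move=> Ox; apply: val_inj; apply: funext => -[|o s] /=; rewrite /wick_act /=.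
  rewrite (fock_op_vacuum cF) ?addr0 // piF //=.
  exact: submodB.
rewrite (linear_fun0 (op_lin _)) !add0r (bO (valP o) Ox) scale0r add0r.
by elim: s => [//|o' s IH] /=; rewrite IH scaler0 addr0.
Qed.

Definition wick (xs : seq M) : sub_lmod wick_fun := foldr wick_rho wick_vacuum xs.

(** Only the value at the empty list is kept: this is the normal ordering map,
    whose well-definedness rests on the universal property. *)
Lemma wick_retraction : exists Phi : {linear fock b O -> V},
  forall xs, Phi (fock_word b O xs) = val (wick xs) [::].
Proof.
have [f fE] := fock_lift bO wick_rho_linear wick_rho_linearl wick_rho_comm
  wick_rho_vacuum.
have gl : linear (fun w => val (f w) [::]) by move=> a u v; rewrite !linearP.
pose lg := GRing.isLinear.Build R (fock b O) V *:%R _ gl.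
pose g : {linear fock b O -> V} := HB.pack (fun w => val (f w) [::]) lg.
by exists g => xs; rewrite /= fE.
Qed.

(** For [x] in [P], the vector [q x] is in [P] as well, and equivariance puts the
    two parts of [x] together again. *)
Lemma wick_act_reduced (x : sub_lmod P) f :
  f \in wick_fun -> wick_act (val x) f [::] = fock_op (pi x) (f [::]).
Proof.
move=> /asboolP[_ _ fe]; rewrite /wick_act /= addr0.
have Pq : q (val x) = val (x - red_part (val x)).
  by rewrite raddfB /= opprB addrC subrK.
rewrite (fe (reg_part (val x)) _ [::] Pq) -(linear_funD (fock_op_linearl _)).
by rewrite -raddfD addrC subrK.
Qed.

Lemma fock_word_isotropic (o : T) s : fock_word b O [seq val r | r <- o :: s] = 0.
Proof.
elim: s o => [|o' s IH] o; first exact: (fock_op_vacuum bO (valP o)).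
by rewrite -[LHS]/(fock_op (val o) (fock_word b O [seq val r | r <- o' :: s])) IH
  (linear_fun0 (fock_op_linear _)).
Qed.

Lemma fock_word_contract x xs (s : seq T) :
  fock_word b O ([seq val r | r <- s] ++ x :: xs) =
  fock_op x (fock_word b O ([seq val r | r <- s] ++ xs)) +
  contract b (fun r => fock_word b O ([seq val o | o <- r] ++ xs)) x s.
Proof.
elim: s => [|o s IH] /=; first by rewrite addr0.
rewrite IH (linear_funD (fock_op_linear _)).
rewrite (linear_contract _ _ _ _ (fock_op_linear _)) addrA; congr (_ + _).
by rewrite -(fock_op_comm bb bO) addrC subrK.
Qed.

(** Normal ordering does not change a vector modulo a quotient in which [P] acts
    through [pi].  The lists [s] are carried along since the recursion adds
    entries to them. *)
Lemma wick_normal_order (Z : lmodType R) (kappa : {linear fock b O -> Z})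
    (Psi : {linear V -> Z}) :
    Psi (vacuum c F) = kappa (vacuum b O) ->
    (forall (x : sub_lmod P) v w, Psi v = kappa w ->
       Psi (fock_op (pi x) v) = kappa (fock_op (val x) w)) ->
  forall xs s, Psi (val (wick xs) s) =
               kappa (fock_word b O ([seq val r | r <- s] ++ xs)).
Proof.
move=> Psi0 PsiP; elim=> [|x xs IH] s.
  by case: s => [|o s]; rewrite ?cats0 // fock_word_isotropic /= !linear0.
rewrite fock_word_contract -[wick _]/(wick_rho x (wick xs)) /= /wick_act.
rewrite !raddfD /= (PsiP _ _ _ (IH s)) IH.
rewrite !(linear_contract _ _ _ _ (linearP _)).
rewrite -raddfD -(linear_funD (fock_op_linearl _)) /= subrK.
by congr (_ + _); apply: eq_contract.
Qed.

Section Coinvariants.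
Variable A : submodClosed M.
Hypotheses (pi_surj : forall y, exists x, pi x = y)
  (pi_ker : forall x, pi x = 0 -> val x \in A).
Hypotheses (AP : {subset A <= P}) (pi_A : forall x, val x \in A -> pi x = 0).

Lemma form_A_P a x : a \in A -> x \in P -> b x a = 0.
Proof.
move=> Aa Px; have Pa := AP Aa.
have := pi_form (Sub x Px) (Sub a Pa).
by rewrite (pi_A (x := Sub a Pa)) // bform0r // => ->.
Qed.

Lemma fock_op_act_sub a w : a \in A -> fock_op a w \in @act_sub R M b O A.
Proof.
by move=> Aa; apply/asboolP; exists [:: (a, w)]; rewrite /= Aa big_seq1.
Qed.

(** Operators from [P] commute with those from [A], which is orthogonal to [P]. *)
Lemma act_sub_stable x w :
  x \in P -> w \in @act_sub R M b O A -> fock_op x w \in @act_sub R M b O A.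
Proof.
move=> Px /asboolP[s [sA ->]]; rewrite (linear_fun_sum (fock_op_linear _)).
rewrite big_seq; apply: rpred_sum => p /(allP sA) Ap.
have := fock_op_comm bb bO x p.1 p.2; rewrite form_A_P // scale0r => /subr0_eq ->.
exact: fock_op_act_sub.
Qed.

Definition reduced_op (y : H) (w : coinvariants b O A) : coinvariants b O A :=
  quot_pi (@act_sub R M b O A) (fock_op (val (projT1 (cid (pi_surj y)))) (quot_repr w)).

(** Two lifts differ by an element of [A], and two representatives by an element of
    the submodule, which is stable under [P]. *)
Lemma reduced_opE x w :
  reduced_op (pi x) (quot_pi _ w) = quot_pi _ (fock_op (val x) w).
Proof.
rewrite /reduced_op; case: (cid _) => x' /= pix'.
apply/quot_piP; set w' := quot_repr _.
have -> : fock_op (sval x') w' - fock_op (sval x) w =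
    fock_op (val (x' - x)) w' + fock_op (val x) (w' - w).
  rewrite raddfB (linear_funB (fock_op_linearl _)) (linear_funB (fock_op_linear _)).
  by rewrite addrA subrK.
apply: rpredD; first by apply/fock_op_act_sub/pi_ker; rewrite raddfB /= pix' subrr.
apply: act_sub_stable (valP x) _.
by apply/quot_piP; rewrite quot_reprK.
Qed.

Lemma coinvariants_ind (Q : coinvariants b O A -> Prop) :
  (forall w, Q (quot_pi _ w)) -> forall z, Q z.
Proof. by move=> Qw z; rewrite -[z]quot_reprK. Qed.

Lemma reduced_op_linear y : linear (reduced_op y).
Proof.
have [x <-] := pi_surj y.
move=> a; elim/coinvariants_ind=> u; elim/coinvariants_ind=> v.
by rewrite -linearP !reduced_opE -linearP fock_op_linear.
Qed.

Lemma reduced_op_linearl z : linear (reduced_op^~ z).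
Proof.
elim/coinvariants_ind: z => w a y y'.
have [x <-] := pi_surj y; have [x' <-] := pi_surj y'.
by rewrite -linearP !reduced_opE -linearP -(fock_op_linearl _) linearP.
Qed.

Lemma reduced_op_comm y y' z :
  reduced_op y (reduced_op y' z) - reduced_op y' (reduced_op y z) = c y y' *: z.
Proof.
elim/coinvariants_ind: z => w.
have [x <-] := pi_surj y; have [x' <-] := pi_surj y'.
by rewrite !reduced_opE -raddfB (fock_op_comm bb bO) pi_form; exact: quot_piZ.
Qed.

(** Psi comes from the action of [H] on the coinvariants, and its inverse is
    induced by normal ordering, which kills [A o F(M, O)] because it is
    equivariant under [P] and [A] projects to 0. *)
Lemma fock_reduction (F_lift : forall y, y \in F ->
    exists2 x, val x \in O & y = pi x) :
  exists Psi : {linear fock c F -> coinvariants b O A},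
    bijective Psi /\
    forall xs : seq (sub_lmod P), Psi (fock_word c F [seq pi x | x <- xs]) =
      quot_pi (@act_sub R M b O A) (fock_word b O [seq val x | x <- xs]).
Proof.
have vac0 y : y \in F -> reduced_op y (quot_pi _ (vacuum b O)) = 0.
  by move=> /F_lift[x Ox ->]; rewrite reduced_opE (fock_op_vacuum bO) // linear0.
have [Psi PsiE] := fock_lift cF reduced_op_linear reduced_op_linearl
  reduced_op_comm vac0.
have [Phi PhiE] := wick_retraction.
have PsiP : forall xs : seq (sub_lmod P),
    Psi (fock_word c F [seq pi x | x <- xs]) =
    quot_pi (@act_sub R M b O A) (fock_word b O [seq val x | x <- xs]).
  by move=> xs; rewrite PsiE; elim: xs => [//|x xs IH] /=; rewrite IH reduced_opE.
have Psi_op x v w : Psi v = quot_pi _ w ->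
    Psi (fock_op (pi x) v) = quot_pi _ (fock_op (val x) w).
  move=> vw; rewrite -reduced_opE -vw.
  have Psi_lin : linear (fun v => Psi (fock_op (pi x) v)).
    by move=> a u v'; rewrite fock_op_linear linearP.
  have op_Psi_lin : linear (fun v => reduced_op (pi x) (Psi v)).
    by move=> a u v'; rewrite linearP reduced_op_linear.
  apply: (fock_linear_ext bc cF Psi_lin op_Psi_lin) => xs.
  by rewrite -[fock_op _ _]/(fock_word c F (pi x :: xs)) !PsiE.
have Phi_op x w : Phi (fock_op (val x) w) = fock_op (pi x) (Phi w).
  have l1 : linear (fun w => Phi (fock_op (val x) w)).
    by move=> a u v; rewrite fock_op_linear linearP.
  have l2 : linear (fun w => fock_op (pi x) (Phi w)).
    by move=> a u v; rewrite linearP fock_op_linear.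
  apply: (fock_linear_ext bb bO l1 l2) => xs.
  rewrite -[fock_op _ _]/(fock_word b O (val x :: xs)) !PhiE.
  exact: (wick_act_reduced x (valP (wick xs))).
have Phi_A w : w \in @act_sub R M b O A -> Phi w = 0.
  move=> /asboolP[s [sA ->]]; rewrite linear_sum big_seq big1 // => p /(allP sA) Ap.
  have := Phi_op (Sub p.1 (AP Ap)) p.2 => /= ->.
  by rewrite pi_A // (linear_fun0 (fock_op_linearl _)).
have PhiK w : Phi (quot_repr (quot_pi (@act_sub R M b O A) w)) = Phi w.
  apply/eqP; rewrite -subr_eq0 -linearB; apply/eqP/Phi_A.
  by apply/quot_piP; rewrite quot_reprK.
exists Psi; split=> //; exists (fun z => Phi (quot_repr z)) => [v|z].
  have Phi_Psi_lin : linear (fun v => Phi (quot_repr (Psi v))).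
    move=> a u v'; rewrite linearP -[Psi u]quot_reprK -[Psi v']quot_reprK.
    by rewrite -linearP !PhiK linearP.
  apply: (fock_linear_ext bc cF (g := id) Phi_Psi_lin) => // xs.
  have [ys ->] : exists ys, xs = [seq pi y | y <- ys].
    elim: xs => [|x xs [ys ->]]; first by exists [::].
    by have [y <-] := pi_surj x; exists (y :: ys).
  rewrite PsiP PhiK; elim: ys => [|y ys IH]; first by rewrite PhiE.
  by rewrite /= Phi_op IH.
elim/coinvariants_ind: z => w; rewrite PhiK.
have Psi_Phi_lin : linear (fun w => Psi (Phi w)) by move=> a u v; rewrite !linearP.
have pi_lin : linear (quot_pi (@act_sub R M b O A)) by exact: linearP.
apply: (fock_linear_ext bb bO Psi_Phi_lin pi_lin) => xs.
by rewrite PhiE; exact: (wick_normal_order (PsiP [::]) Psi_op xs [::]).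
Qed.

End Coinvariants.

End Wick.

(** * Forms with a split symplectic basis *)

Definition lin_comb (R : comNzRingType) (V : lmodType R) (n : nat)
    (u : 'I_n -> V) (a : 'I_n -> R) : V := \sum_i a i *: u i.

Section LinComb.
Variables (R : comNzRingType) (V : lmodType R) (n : nat).
Implicit Types (u v : 'I_n -> V) (a : 'I_n -> R).

Lemma lin_combB u v a :
  lin_comb (fun i => u i - v i) a = lin_comb u a - lin_comb v a.
Proof. by rewrite -sumrB; apply: eq_bigr => i _; rewrite scalerBr. Qed.

Lemma linear_lin_comb (W : lmodType R) (f : {linear V -> W}) u a :
  f (lin_comb u a) = lin_comb (fun i => f (u i)) a.
Proof. by rewrite linear_sum; apply: eq_bigr => i _; rewrite linearZ_LR. Qed.

Lemma rpred_lin_comb (S : submodClosed V) u a :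
  (forall i, u i \in S) -> lin_comb u a \in S.
Proof. by move=> Su; apply: rpred_sum => i _; apply/rpredZ/Su. Qed.
End LinComb.

Section SymplecticBasis.
Variables (R : comNzRingType) (V : lmodType R) (b : V -> V -> R).
Variables (n : nat) (o e : 'I_n -> V).
Hypotheses (bb : bilinear_form b) (b_anti : forall x y, b x y = - b y x).
Hypotheses (b_oo : forall i j, b (o i) (o j) = 0)
  (b_oe : forall i j, b (o i) (e j) = (i == j)%:R).

Hypothesis span_oe : forall y, exists al be, y = lin_comb o al + lin_comb e be.

Lemma form_lin_combr x (u : 'I_n -> V) a : b x (lin_comb u a) = \sum_i a i * b x (u i).
Proof. by rewrite bform_sumr //; apply: eq_bigr => i _; rewrite bformZr. Qed.

Lemma form_lin_combl x (u : 'I_n -> V) a : b (lin_comb u a) x = \sum_i a i * b (u i) x.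
Proof. by rewrite bform_suml //; apply: eq_bigr => i _; rewrite bformZl. Qed.

Lemma sum_delta (a : 'I_n -> R) (i : 'I_n) : \sum_j a j * (i == j)%:R = a i.
Proof.
rewrite (bigD1 i) //= eqxx mulr1 big1 ?addr0 // => j ji.
by rewrite eq_sym (negPf ji) mulr0.
Qed.

Lemma form_o i al be : b (o i) (lin_comb o al + lin_comb e be) = be i.
Proof.
rewrite bformDr // !form_lin_combr big1 ?add0r => [|j _]; last by rewrite b_oo mulr0.
by rewrite -[RHS]sum_delta; apply: eq_bigr => j _; rewrite b_oe.
Qed.

Lemma form_e j al be : b (lin_comb o al + lin_comb e be) (e j) =
  al j + \sum_i be i * b (e i) (e j).
Proof.
rewrite bformDl // !form_lin_combl; congr (_ + _).
by rewrite -[RHS]sum_delta; apply: eq_bigr => i _; rewrite b_oe eq_sym.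
Qed.

(** The form reads off the coordinates in the spanning family: those on [e] by
    pairing with [o], then those on [o] by pairing with [e]. *)
Lemma symplectic_free : free_of_rank V (2 * n).
Proof.
rewrite mul2n -addnn.
pose f (v : 'rV[R]_(n + n)) :=
  lin_comb o (lsubmx v 0) + lin_comb e (rsubmx v 0).
have fl : linear f.
  move=> a u v; rewrite /f /lin_comb scalerDr addrACA !scaler_sumr -!big_split /=.
  by apply: eq_bigr => i _; rewrite !mxE !scalerDl !scalerA.
pose lf := GRing.isLinear.Build R 'rV[R]_(n + n) V *:%R f fl.
pose F : {linear 'rV[R]_(n + n) -> V} := HB.pack f lf.
exists F.
pose g y : 'rV[R]_(n + n) := row_mx
  (\row_j (b y (e j) - \sum_i b (o i) y * b (e i) (e j))) (\row_i b (o i) y).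
exists g => [v|y] /=.
  rewrite /g /f -[RHS]hsubmxK; congr row_mx; apply/rowP => j; rewrite !mxE.
    rewrite form_e; under [X in _ - X]eq_bigr do rewrite form_o.
    by rewrite addrK mxE.
  by rewrite form_o mxE.
have [al [be ->]] := span_oe y; rewrite /f /g row_mxKl row_mxKr.
congr (_ + _); apply: eq_bigr => j _; rewrite mxE ?form_o // form_e.
by under [X in _ - X]eq_bigr do rewrite form_o; rewrite addrK.
Qed.

Lemma symplectic_nondegenerate : nondegenerate_form b.
Proof.
split=> [x bx0|phi].
  have [al [be xE]] := span_oe x.
  have be0 i : be i = 0 by rewrite -(form_o i al be) -xE b_anti bx0 oppr0.
  have al0 i : al i = 0.
    have := bx0 (e i); rewrite xE form_e => <-.
    by rewrite big1 ?addr0 // => j _; rewrite be0 mul0r.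
  rewrite xE /lin_comb !big1 ?addr0 // => i _; first by rewrite be0 scale0r.
  by rewrite al0 scale0r.
(* Pairing with o_i prescribes be_i, up to the sign of antisymmetry; pairing
   with e_j then prescribes al_j. *)
pose be i : R := - phi (o i).
pose al j : R := phi (e j) - \sum_i be i * b (e i) (e j).
exists (lin_comb o al + lin_comb e be) => y.
have [al' [be' ->]] := span_oe y.
rewrite linearD !linear_sum bformDr // !form_lin_combr; congr (_ + _);
  apply: eq_bigr => i _; rewrite linearZ_LR /=; congr (_ * _).
  by rewrite b_anti form_o opprK.
by rewrite form_e subrK.
Qed.

Lemma symplectic_maximal_isotropic (F : submodClosed V) :
  isotropic b F -> (forall i, o i \in F) -> maximal_isotropic b F.
Proof.
move=> Fi Fo; split=> // G Gi FG x Gx.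
have [al [be xE]] := span_oe x.
have be0 i : be i = 0 by rewrite -(form_o i al be) -xE Gi // FG.
rewrite xE rpredD //; apply: rpred_sum => i _; first exact: rpredZ.
by rewrite be0 scale0r rpred0.
Qed.

End SymplecticBasis.

(** * Duality for the residue form *)

(** [ninv n] is the inverse of n + 1; it is a datum because [R] has no inversion
    in its structure. *)
Section ResidueDuality.
Variables (R : comNzRingType) (O K : comAlgType R) (D : formal_disk O K).
Variable ninv : nat -> R.
Hypothesis ninvP : forall n, ninv n * n.+1%:R = 1.

Local Notation loc := (disk_loc D).
Local Notation tinv := (disk_tinv D).
Local Notation coord := (disk_coord D).
Local Notation form := (residue_form D).
Local Notation OK := (Osub D).

Lemma OsubP x : reflect (exists f, x = loc f) (x \in OK).
Proof. exact: asboolP. Qed.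

Lemma loc_Osub f : loc f \in OK.
Proof. by apply/OsubP; exists f. Qed.

Lemma coord_Oderiv f : coord (Oderiv D f) = fps_deriv (coord f).
Proof. exact: disk_coord_invK. Qed.

(** The residue is the coefficient of index n + m - 1 of the numerator for the
    term with the derivative of f, and of index n + m for the term with the
    derivative of t^-n. *)
Lemma form_frac f g n m :
  form (loc f * tinv ^+ n) (loc g * tinv ^+ m) =
  (if (n + m)%N is k.+1 then fps_coef (coord g * fps_deriv (coord f)) k else 0)
  - fps_coef (coord g * coord f) (n + m) *+ n.
Proof.
rewrite /residue_form ddtE mulrBr.
have E1 : loc g * tinv ^+ m * (loc (Oderiv D f) * tinv ^+ n) =
    loc (g * Oderiv D f) * tinv ^+ (n + m).
  by rewrite rmorphM mulrACA -exprD addnC.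
have E2 : loc g * tinv ^+ m * ((loc f * tinv ^+ n * tinv) *+ n) =
    loc ((g * f) *+ n) * tinv ^+ (n + m).+1.
  by rewrite mulrnAr -[loc f * _ * _]mulrA -exprSr mulrACA -exprD rmorphMn rmorphM mulrnAl addnS addnC.
rewrite E1 E2 (linear_funB (residue_linear D)) !residueE !rmorphM /= coord_Oderiv.
have coefMn (h : fps R) k l : fps_coef (h *+ l) k = fps_coef h k *+ l.
  by elim: l => [//|l IH]; rewrite !mulrSr -IH.
by rewrite rmorphMn rmorphM /= coefMn.
Qed.

Lemma fps_coef_deriv_prod (f g : fps R) N :
  fps_coef (g * fps_deriv f) N + fps_coef (f * fps_deriv g) N =
  fps_coef (g * f) N.+1 *+ N.+1.
Proof.
have -> : fps_coef (g * fps_deriv f) N =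
    \sum_(i < N.+2) fps_coef g i * fps_coef f (N.+1 - i)%N *+ (N.+1 - i).
  rewrite big_ord_recr /= subnn mulr0n addr0; apply: eq_bigr => i _.
  by rewrite mulrnAr subSn // -ltnS.
have -> : fps_coef (f * fps_deriv g) N =
    \sum_(i < N.+2) fps_coef g i * fps_coef f (N.+1 - i)%N *+ i.
  rewrite (mulrC f) big_ord_recl mulr0n add0r; apply: eq_bigr => i _ /=.
  by rewrite mulrnAl.
rewrite -big_split [fps_coef _ N.+1]/= -sumrMnl; apply: eq_bigr => i _.
by rewrite /= -mulrnDr subnK // -ltnS.
Qed.

Lemma residue_form_bilinear : bilinear_form form.
Proof.
split=> [y|x a y z]; first exact: residue_form_linearl.
by rewrite /residue_form mulrDl -scalerAl (residue_linear D).
Qed.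

Lemma residue_form_anti x y : form x y = - form y x.
Proof.
have [n [f [g [-> ->]]]] := common_frac D x y.
apply/eqP; rewrite -subr_eq0 opprK !form_frac (mulrC (coord f) (coord g)).
have := fps_coef_deriv_prod (coord f) (coord g).
set p := coord g * coord f; set p1 := coord g * _; set p2 := coord f * _ => H.
case: n => [|n]; first by rewrite !mulr0n !subr0 addr0.
rewrite addrACA [X in X + _]H -opprD -mulrnDr.
by rewrite addSn subrr.
Qed.

Lemma residue_form_isotropic : isotropic form OK.
Proof.
move=> _ _ /OsubP[f ->] /OsubP[g ->].
rewrite -[loc f]mulr1 -[loc g]mulr1 -(expr0 tinv) form_frac /= mulr0n.
by rewrite subr0.
Qed.

(** The poles pair with the powers of [t] in a diagonal way, with entries the
    positive integers. *)
Lemma residue_form_pole f k :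
  form (loc f) (tinv ^+ k.+1) = fps_coef (coord f) k.+1 *+ k.+1.
Proof.
have -> : form (loc f) (tinv ^+ k.+1) = form (loc f * tinv ^+ 0) (loc 1 * tinv ^+ k.+1).
  by rewrite expr0 mulr1 [loc 1]rmorph1 mul1r.
by rewrite form_frac mulr0n subr0 [coord 1]rmorph1 mul1r.
Qed.

(** A fraction is the sum of its polar part and an element of [O]; the polar part
    is split off one pole at a time. *)
Lemma disk_linear_ext (X : lmodType R) (h h' : K -> X) :
    linear h -> linear h' -> (forall x, x \in OK -> h x = h' x) ->
    (forall k, h (tinv ^+ k.+1) = h' (tinv ^+ k.+1)) ->
  h =1 h'.
Proof.
move=> hl hl' hO ht x; have [[n f] /= ->] := disk_fracP D x; elim: n f => [|n IH] f.
  by rewrite mulr1 hO // loc_Osub.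
pose f1 := disk_coord_inv D (Fps (fun k => fps_coef (coord f) k.+1)).
have fE : f = fps_coef (coord f) 0 *: 1 + f1 * disk_t D.
  apply: (can_inj (disk_coordK D)).
  rewrite linearP rmorph1 rmorphM /= coord_t disk_coord_invK.
  set g := Fps _; apply: fpsP => k.
  rewrite -[RHS]/(fps_coef (coord f) 0 * fps_coef 1 k + fps_coef (g * fpsX R) k).
  by rewrite fps_coefMX; case: k => [|k]; rewrite /= ?mulr1 ?mulr0 ?addr0 ?add0r.
have -> : loc f * tinv ^+ n.+1 =
    fps_coef (coord f) 0 *: tinv ^+ n.+1 + loc f1 * tinv ^+ n.
  rewrite {1}fE linearP rmorph1 rmorphM mulrDl -scalerAl mul1r; congr (_ + _).
  by rewrite exprS mulrA -(mulrA (loc f1)) (disk_tinvP D) mulr1.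
by rewrite hl hl' IH ht.
Qed.

(** The coefficients are forced by [residue_form_pole].  The constant one, at
    [k = 0], is free since scalars are in the radical of the form; the formula
    for it is an arbitrary choice that is linear in [h]. *)
Definition dual_rep (h : K -> R) : K :=
  loc (disk_coord_inv D (Fps (fun k => ninv k.-1 * h (tinv ^+ k)))).

Lemma dual_rep_Osub h : dual_rep h \in OK.
Proof. exact: loc_Osub. Qed.

Lemma dual_repP h : linear (h : K -> R^o) -> (forall x, x \in OK -> h x = 0) ->
  forall x, form (dual_rep h) x = h x.
Proof.
move=> hl hO; apply: (disk_linear_ext (X := R^o)) => //.
- exact: residue_form_bilinear.2.
- by move=> x Ox; rewrite hO // residue_form_isotropic ?dual_rep_Osub.
- move=> k; rewrite residue_form_pole disk_coord_invK /= -mulr_natr mulrAC.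
  by rewrite ninvP mul1r.
Qed.

Lemma dual_rep_linear a h h' :
  dual_rep (fun y => a * h y + h' y) = a *: dual_rep h + dual_rep h'.
Proof.
rewrite /dual_rep -(linearP loc); congr (loc _); apply: (can_inj (disk_coordK D)).
rewrite linearP /= !disk_coord_invK; apply: fpsP => k /=.
by rewrite mulrDr mulrCA.
Qed.

Lemma form_const a x : form a%:A x = 0.
Proof.
rewrite bformZl; last exact: residue_form_bilinear.
suff -> : form 1 x = 0 by rewrite mulr0.
rewrite -[1](rmorph1 loc); apply: (disk_linear_ext (X := R^o) (h := form (loc 1)) (h' := fun=> 0)).
- exact: residue_form_bilinear.2.
- by move=> c u v; rewrite scaler0 addr0.
- by move=> y Oy; rewrite residue_form_isotropic // loc_Osub.
- by move=> k; rewrite residue_form_pole rmorph1 mul0rn.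
Qed.

Lemma form_radical x : x \in OK -> (forall y, form x y = 0) -> exists a : R, x = a%:A.
Proof.
move=> /OsubP[f ->] fy; exists (fps_coef (coord f) 0).
rewrite -(rmorph1 loc) -(linearZ_LR loc); congr (loc _); apply: (can_inj (disk_coordK D)).
rewrite linearZ rmorph1; apply: fpsP => -[|k] /=; first by rewrite mulr1.
rewrite mulr0 -[LHS]mul1r -(ninvP k) -mulrA mulr_natl.
by rewrite -residue_form_pole fy mulr0.
Qed.

End ResidueDuality.

(** * Isotropic subalgebras with free cokernel *)

Section IsotropicSubalgebra.
Variables (R : comNzRingType) (O K : comAlgType R) (D : formal_disk O K).
Variable ninv : nat -> R.
Hypothesis ninvP : forall n, ninv n * n.+1%:R = 1.
Variable A : subalgClosed K.
Hypothesis A_cap : forall x : K, (x \in A) && (x \in Osub D) <-> exists a : R, x = a%:A.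
Hypothesis A_isotropic : isotropic (residue_form D) A.

Local Notation form := (residue_form D).
Local Notation OK := (Osub D).
Let bb := residue_form_bilinear D.

Lemma perpP x : reflect (forall a, a \in A -> form x a = 0) (x \in perp D A).
Proof. exact: asboolP. Qed.

Lemma sub_perp : {subset A <= perp D A}.
Proof. by move=> x Ax; apply/perpP => a Aa; apply: A_isotropic. Qed.

Lemma HA_class_surj y : exists x, HA_class D A x = y.
Proof. by exists (quot_repr y); apply: quot_reprK. Qed.

Lemma HA_class_eq0 x : HA_class D A x = 0 <-> val x \in A.
Proof.
rewrite -(linear0 (HA_class D A)); split=> [/quot_piP|Ax].
  by rewrite subr0.
by apply/quot_piP; rewrite subr0.
Qed.

Lemma HA_formE x y :
  HA_form D A (HA_class D A x) (HA_class D A y) = form (val x) (val y).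
Proof.
rewrite /HA_form; set x' := quot_repr _; set y' := quot_repr _.
have xA : val (x' - x) \in A by apply/HA_class_eq0; rewrite linearB /= quot_reprK subrr.
have yA : val (y' - y) \in A by apply/HA_class_eq0; rewrite linearB /= quot_reprK subrr.
have -> : val x' = val (x' - x) + val x by rewrite raddfB subrK.
have /perpP yP := valP y'; have /perpP xP := valP x.
rewrite bformDl // (residue_form_anti D (val (x' - x))) yP // oppr0 add0r.
have -> : val y' = val (y' - y) + val y by rewrite raddfB subrK.
by rewrite bformDr // xP // add0r.
Qed.

Lemma HA_form_bilinear : bilinear_form (HA_form D A).
Proof.
split=> [y a x x'|x a y y'].
  have [u <-] := HA_class_surj x; have [u' <-] := HA_class_surj x'.
  have [v <-] := HA_class_surj y.
  by rewrite -linearP !HA_formE linearP bformDl // bformZl.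
have [u <-] := HA_class_surj y; have [u' <-] := HA_class_surj y'.
have [v <-] := HA_class_surj x.
by rewrite -linearP !HA_formE linearP bformDr // bformZr.
Qed.

Lemma HA_form_anti x y : HA_form D A x y = - HA_form D A y x.
Proof.
have [u <-] := HA_class_surj x; have [v <-] := HA_class_surj y.
by rewrite !HA_formE -residue_form_anti.
Qed.

Lemma FAP y :
  y \in FA D A <-> exists2 x, val x \in OK & y = HA_class D A x.
Proof. by split=> [/asboolP|H]; last exact/asboolP. Qed.

Lemma FA_isotropic : isotropic (HA_form D A) (FA D A).
Proof.
move=> _ _ /FAP[x Ox ->] /FAP[y Oy ->].
by rewrite HA_formE residue_form_isotropic.
Qed.

Section Basis.
Variables (d : nat) (phi : {linear 'rV[R]_d -> quot_lmod (sum_sub A OK)}).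
Variable phi' : quot_lmod (sum_sub A OK) -> 'rV[R]_d.
Hypotheses (phiK : cancel phi phi') (phi'K : cancel phi' phi).

(** The name recalls Weierstrass gaps: the quotient by [A + O] measures the polar
    parts that no element of [A] attains. *)
Definition gap_coord (i : 'I_d) (x : K) : R := phi' (quot_pi (sum_sub A OK) x) 0 i.
Definition gap_lift (i : 'I_d) : K := quot_repr (phi (delta_mx 0 i)).

Lemma gap_coord_linear i : linear (gap_coord i : K -> R^o).
Proof.
have phi'_lin : linear phi' := can2_linear phiK phi'K.
by move=> a x y; rewrite /gap_coord linearP phi'_lin !mxE.
Qed.

Lemma gap_coord_eq0 i x : x \in sum_sub A OK -> gap_coord i x = 0.
Proof.
move=> Sx; rewrite /gap_coord; have -> : quot_pi (sum_sub A OK) x = phi 0.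
  by rewrite linear0 -(linear0 (quot_pi _)); apply/quot_piP; rewrite subr0.
by rewrite phiK mxE.
Qed.

Lemma gap_coord_A i x : x \in A -> gap_coord i x = 0.
Proof.
by move=> Ax; apply/gap_coord_eq0/asboolP; exists x, 0; rewrite rpred0 addr0.
Qed.

Lemma gap_coord_O i x : x \in OK -> gap_coord i x = 0.
Proof.
by move=> Ox; apply/gap_coord_eq0/asboolP; exists 0, x; rewrite rpred0 add0r.
Qed.

Lemma gap_coord_lift i j : gap_coord i (gap_lift j) = (i == j)%:R.
Proof. by rewrite /gap_coord quot_reprK phiK mxE eqxx eq_sym. Qed.

Lemma gap_decomposition x : exists a o, [/\ a \in A, o \in OK
  & x = lin_comb gap_lift (gap_coord^~ x) + (a + o)].
Proof.
pose y := lin_comb gap_lift (gap_coord^~ x).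
have : x - y \in sum_sub A OK.
  apply/quot_piP; rewrite -[LHS]phi'K; rewrite /y /lin_comb linear_sum.
  rewrite [X in phi X]row_sum_delta linear_sum; apply: eq_bigr => i _.
  by rewrite !linearZ_LR /= quot_reprK.
by move=> /asboolP[a [o [Aa Oo E]]]; exists a, o; split; rewrite // -E addrC subrK.
Qed.

(** The component of [x] in [A] in a decomposition along the gap lifts, [A] and
    [O]; it is determined up to a scalar. *)
Definition A_part x : K := projT1 (cid (gap_decomposition x)).

Lemma A_partP x : exists o, [/\ A_part x \in A, o \in OK
  & x = lin_comb gap_lift (gap_coord^~ x) + (A_part x + o)].
Proof. exact: (projT2 (cid (gap_decomposition x))). Qed.

Lemma form_scalars x a : form x a%:A = 0.
Proof. by rewrite residue_form_anti form_const oppr0. Qed.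

(** The two components in [A] differ by an element of both [A] and [O], hence by a
    scalar, and scalars are in the radical of the form. *)
Lemma form_A_part_unique x a a' o o' :
  a \in A -> a' \in A -> o \in OK -> o' \in OK -> a + o = a' + o' ->
  form x a = form x a'.
Proof.
move=> Aa Aa' Oo Oo' E; apply/eqP; rewrite -subr_eq0 -(bformBr bb).
have [|c ->] := (A_cap (a - a')).1; last by rewrite form_scalars.
rewrite submodB //=; have -> : a - a' = o' - o.
  by apply/eqP; rewrite subr_eq addrAC -subr_eq opprK E addrC.
exact: submodB.
Qed.

(** The choice made in [A_part] does not matter: scalars are in the radical. *)
Definition extend_form x (y : K) : R := form x (A_part y).

Lemma lin_comb_coord a x y : lin_comb gap_lift (gap_coord^~ (a *: x + y)) =
  a *: lin_comb gap_lift (gap_coord^~ x) + lin_comb gap_lift (gap_coord^~ y).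
Proof.
rewrite /lin_comb scaler_sumr -big_split; apply: eq_bigr => i _ /=.
by rewrite gap_coord_linear scalerDl scalerA.
Qed.

Lemma extend_form_linear x : linear (extend_form x : K -> R^o).
Proof.
move=> a y z; rewrite /extend_form.
have [o [Aa Oo E]] := A_partP y; have [o' [Aa' Oo' E']] := A_partP z.
have [o'' [Aa'' Oo'' E'']] := A_partP (a *: y + z).
rewrite -[RHS](bb.2 x); apply: (form_A_part_unique x (o := o'') (o' := a *: o + o')) => //.
- by rewrite rpredD ?rpredZ.
- by rewrite rpredD ?rpredZ.
apply: (addrI (lin_comb gap_lift (gap_coord^~ (a *: y + z)))).
rewrite -E'' lin_comb_coord {1}E {1}E' !scalerDr.
by rewrite [LHS](AC ((1*2)*(1*2)) ((1*4)*((2*5)*(3*6)))).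
Qed.

Lemma extend_form_A x a : a \in A -> extend_form x a = form x a.
Proof.
move=> Aa; have [o [Aa' Oo E]] := A_partP a.
apply: (form_A_part_unique x (o := o) (o' := 0)) => //; first exact: rpred0.
rewrite addr0 {2}E /lin_comb big1 ?add0r // => i _.
by rewrite gap_coord_A ?scale0r.
Qed.

Lemma extend_form_O x o : o \in OK -> extend_form x o = 0.
Proof.
move=> Oo; have [o' [Aa' Oo' E]] := A_partP o.
rewrite -(bform0r bb x); apply: (form_A_part_unique x (o := o') (o' := o)) => //.
  exact: rpred0.
rewrite add0r {2}E /lin_comb big1 ?add0r // => i _.
by rewrite gap_coord_O ?scale0r.
Qed.

(** This is the map called [q] in the reduction of Fock modules. *)
Definition reg_rep x : K := dual_rep D ninv (extend_form x).

Lemma reg_rep_linear : linear reg_rep.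
Proof.
move=> a x y; rewrite -dual_rep_linear; congr dual_rep; apply: funext => z.
by rewrite /extend_form bformDl ?bformZl.
Qed.

Lemma reg_rep_Osub x : reg_rep x \in OK. Proof. exact: dual_rep_Osub. Qed.

Lemma reg_rep_perp x : x - reg_rep x \in perp D A.
Proof.
apply/perpP => a Aa; rewrite bformBl // dual_repP //.
- by rewrite extend_form_A ?subrr.
- exact: extend_form_linear.
- by move=> o Oo; apply: extend_form_O.
Qed.

Definition gap_dual (i : 'I_d) : K := dual_rep D ninv (gap_coord i).

Lemma gap_dualP i x : form (gap_dual i) x = gap_coord i x.
Proof.
apply: dual_repP => //; first exact: gap_coord_linear.
exact: gap_coord_O.
Qed.

Lemma gap_dual_perp i : gap_dual i \in perp D A.
Proof. by apply/perpP => a Aa; rewrite gap_dualP gap_coord_A. Qed.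

(** The two halves of the basis of [HA]: the coordinates of [K/(A + O)]
    represented in [O], and its basis vectors lifted to the orthogonal of
    [A]. *)
Definition HA_o i : HA D A := HA_class D A (Sub (gap_dual i) (gap_dual_perp i)).
Definition HA_e i : HA D A :=
  HA_class D A (Sub (gap_lift i - reg_rep (gap_lift i)) (reg_rep_perp (gap_lift i))).

Lemma HA_form_oo i j : HA_form D A (HA_o i) (HA_o j) = 0.
Proof. by rewrite HA_formE residue_form_isotropic // dual_rep_Osub. Qed.

Lemma HA_form_oe i j : HA_form D A (HA_o i) (HA_e j) = (i == j)%:R.
Proof.
rewrite HA_formE /= gap_dualP (linear_funB (gap_coord_linear i)) gap_coord_lift.
by rewrite gap_coord_O ?reg_rep_Osub // subr0.
Qed.

Lemma HA_o_FA i : HA_o i \in FA D A.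
Proof.
apply/FAP; exists (Sub (gap_dual i) (gap_dual_perp i)) => //.
exact: dual_rep_Osub.
Qed.

(** The form of [o] kills [A] and [O], so it is the combination of the coordinates
    with the values on the gap lifts as coefficients; being in the radical, the
    difference is a scalar. *)
Lemma perp_O_span o : o \in OK -> o \in perp D A ->
  o - lin_comb gap_dual (fun i => form o (gap_lift i)) \in A.
Proof.
move=> Oo /perpP Po; set o' := lin_comb _ _.
have Oo' : o' \in OK by apply: rpred_lin_comb => i; apply: dual_rep_Osub.
have [a ->] : exists a : R, o - o' = a%:A.
  apply: (form_radical (D := D) ninvP) => [|y]; first exact: submodB.
  rewrite bformBl // form_lin_combl //.
  have [a [o2 [Aa Oo2 {1}->]]] := gap_decomposition y.
  rewrite !bformDr // (Po a Aa) (residue_form_isotropic Oo Oo2) !addr0.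
  rewrite form_lin_combr // -sumrB big1 // => i _.
  by rewrite gap_dualP mulrC subrr.
by have [_ /(_ (ex_intro _ a erefl)) /andP[]] := A_cap a%:A.
Qed.

Lemma HA_span y : exists al be, y = lin_comb HA_o al + lin_comb HA_e be.
Proof.
have [x <-] := HA_class_surj y.
have [a [o [Aa Oo xE]]] := gap_decomposition (val x).
pose be i := gap_coord i (val x).
pose o' := o + lin_comb (fun i => reg_rep (gap_lift i)) be.
have Oo' : o' \in OK.
  by rewrite rpredD //; apply: rpred_lin_comb => i; apply: reg_rep_Osub.
pose e' := lin_comb (fun i => gap_lift i - reg_rep (gap_lift i)) be.
have xE' : val x = e' + a + o'.
  by rewrite {1}xE /e' /o' lin_combB (addrC o) addrACA subrK.
have Pe' : e' \in perp D A.
  by apply: rpred_lin_comb => i; apply: reg_rep_perp.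
have Po' : o' \in perp D A.
  have -> : o' = val x - (e' + a) by rewrite {1}xE' addrC addKr.
  apply: submodB (valP x) _; apply: rpredD => //; exact: sub_perp.
have := perp_O_span Oo' Po'; set al := fun i => _ => Ao'.
exists al, be; apply/eqP; rewrite -subr_eq0; apply/eqP.
rewrite /HA_o /HA_e -!linear_lin_comb -linearD -linearB; apply/HA_class_eq0.
set u := lin_comb _ al; set w := lin_comb _ be.
have uE : val u = lin_comb gap_dual al by rewrite (linear_lin_comb val).
have wE : val w = e' by rewrite (linear_lin_comb val).
have -> : val (x - (u + w)) = a + (o' - lin_comb gap_dual al).
  have -> : val (x - (u + w)) = val x - (val u + val w) by [].
  rewrite uE wE xE'; move: (e') (o') (lin_comb _ _) => e2 o2 L.
  apply/eqP; rewrite subr_eq.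
  by rewrite -(addrA a) (addrA (o2 - _)) subrK (addrC o2) addrA (addrC a).
exact: rpredD.
Qed.

End Basis.

Lemma isotropic_subalgebra_reduction (d : nat) :
    free_of_rank (quot_lmod (sum_sub A OK)) d ->
  [/\ free_of_rank (HA D A) (2 * d), nondegenerate_form (HA_form D A),
      maximal_isotropic (HA_form D A) (FA D A)
    & exists Psi : {linear fock (HA_form D A) (FA D A) -> coinvariants form OK A},
        bijective Psi /\
        forall xs : seq (sub_lmod (perp D A)),
          Psi (fock_word (HA_form D A) (FA D A) [seq HA_class D A x | x <- xs]) =
          quot_pi (act_sub A) (fock_word form OK [seq val x | x <- xs])].
Proof.
move=> [phi [phi' phiK phi'K]].
have span := HA_span phiK phi'K.
have oo := HA_form_oo phiK phi'K; have oe := HA_form_oe phiK phi'K.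
split.
- exact: symplectic_free HA_form_bilinear oo oe span.
- exact: symplectic_nondegenerate HA_form_bilinear HA_form_anti oo oe span.
- apply: symplectic_maximal_isotropic HA_form_bilinear oo oe span _ FA_isotropic _.
  exact: HA_o_FA.
pose lq := GRing.isLinear.Build R K K *:%R _ (reg_rep_linear phi'K).
pose q : {linear K -> K} := HB.pack (reg_rep phi'K) lq.
apply: (fock_reduction (q := q)).
- exact: bb.
- exact: HA_form_bilinear.
- exact: residue_form_anti.
- exact: residue_form_isotropic.
- exact: FA_isotropic.
- exact: HA_formE.
- by move=> x Ox; apply/FAP; exists x.
- exact: reg_rep_Osub.
- exact: reg_rep_perp.
- exact: HA_class_surj.
- by move=> x /HA_class_eq0.
- exact: sub_perp.
- by move=> x /HA_class_eq0.
- by move=> y /FAP.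
Qed.
End IsotropicSubalgebra.

Theorem proposition4p5 (RR : realType) (R : comAlgType RR[i])
    (O K : comAlgType R) (D : formal_disk O K) (A : subalgClosed K)
    (A_fock : fock_type D A) :
  [/\ forall d : nat,
        free_of_rank (quot_lmod (sum_sub A (Osub D))) d ->
        free_of_rank (HA D A) (2 * d)%N,
      nondegenerate_form (HA_form D A),
      maximal_isotropic (HA_form D A) (FA D A)
    & exists Psi : {linear fock (HA_form D A) (FA D A) ->
                           coinvariants (residue_form D) (Osub D) A},
      [/\ bijective Psi,
          forall xs : seq (sub_lmod (perp D A)),
            Psi (fock_word (HA_form D A) (FA D A)
                   [seq HA_class D A x | x <- xs]) =
            quot_pi (act_sub A)
              (fock_word (residue_form D) (Osub D) [seq val x | x <- xs])
        & forall Psi' : {linear fock (HA_form D A) (FA D A) ->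
                                coinvariants (residue_form D) (Osub D) A},
            (forall xs : seq (sub_lmod (perp D A)),
              Psi' (fock_word (HA_form D A) (FA D A)
                      [seq HA_class D A x | x <- xs]) =
              quot_pi (act_sub A)
                (fock_word (residue_form D) (Osub D) [seq val x | x <- xs])) ->
            Psi' =1 Psi]].
Proof.
(* R contains the rational numbers because it is a complex algebra. *)
pose ninv n : R := (n.+1%:R : RR[i])^-1 *: 1.
have ninvP n : ninv n * n.+1%:R = 1.
  by rewrite /ninv -scalerAl mul1r -[X in _ *: X]scaler_nat scalerA mulVf ?scale1r // Num.Theory.pnatr_eq0.
have A_iso := ft_isotropic A_fock; have A_cap := ft_cap A_fock.
have [d0 free0] := ft_corank A_fock.
have reduction := isotropic_subalgebra_reduction ninvP A_cap A_iso.
have [_ nondeg maxiso [Psi [Psi_bij PsiE]]] := reduction _ free0.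
split=> // [d /reduction[]//|]; exists Psi; split=> // Psi' Psi'E.
have Psi'_lin : linear Psi' by exact: linearP.
have Psi_lin : linear Psi by exact: linearP.
have form_bilin : bilinear_form (HA_form D A) by exact: HA_form_bilinear.
apply: (fock_linear_ext form_bilin maxiso.1 Psi'_lin Psi_lin) => xs.
have [ys ->] : exists ys, xs = [seq HA_class D A y | y <- ys].
  elim: xs => [|x xs [ys ->]]; first by exists [::].
  by have [y <-] := HA_class_surj x; exists (y :: ys).
by rewrite Psi'E PsiE.
Qed.
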